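(* Let $n\in\mathbb{N}$ and let $A\in\mathfrak{d}$. Then the following are equivalent: (i) $A\in\mathfrak{d}_+$. (ii) $\exp A$ has an infinitely divisible representing measure. (iii) $\exp(tA)$ has an infinitely divisible representing measure for some $t>0$. (iv) $\exp(tA)$ has an infinitely divisible representing measure for all $t>0$.
   Context: $\mathbb{N}_0=\{0,1,2,\dots\}$, $\partial^\alpha=\partial_1^{\alpha_1}\cdots\partial_n^{\alpha_n}$ and $\alpha!=\alpha_1!\cdots\alpha_n!$ for $\alpha\in\mathbb{N}_0^n$. Every formal power series $\sum_{\alpha\in\mathbb{N}_0^n} q_\alpha\partial^\alpha\in\mathbb{R}[[\partial_1,\dots,\partial_n]]$ with $q_\alpha\in\mathbb{R}$ acts as a linear operator on $\mathbb{R}[x_1,\dots,x_n]$ (only finitely many terms act non-trivially on a given polynomial). Let $\mathfrak{D}=\{\sum_{\alpha} q_\alpha\partial^\alpha : q_\alpha\in\mathbb{R},\ q_0=1\}$ and $\mathfrak{d}=\{\sum_{\alpha\neq 0} d_\alpha\partial^\alpha : d_\alpha\in\mathbb{R}\}$. For $A\in\mathfrak{d}$, $\exp A:=\sum_{k\in\mathbb{N}_0}\frac{A^k}{k!}\in\mathfrak{D}$ (coefficient-wise convergent). $\mathrm{Pos}(\mathbb{R}^n)=\{p\in\mathbb{R}[x_1,\dots,x_n] : p(x)\ge 0 \text{ for all } x\in\mathbb{R}^n\}$. A linear map $T:\mathbb{R}[x_1,\dots,x_n]\to\mathbb{R}[x_1,\dots,x_n]$ is a positivity preserver if $T\,\mathrm{Pos}(\mathbb{R}^n)\subseteq\mathrm{Pos}(\mathbb{R}^n)$.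 $\mathfrak{D}_+$ is the set of all $A\in\mathfrak{D}$ that are positivity preservers, and $\mathfrak{d}_+=\{A\in\mathfrak{d} : \exp(tA)\in\mathfrak{D}_+\text{ for all } t\ge 0\}$. Measures are non-negative Borel measures on $\mathbb{R}^n$. A representing measure of $T=\sum_\alpha q_\alpha\partial^\alpha\in\mathfrak{D}$ is a measure $\mu$ on $\mathbb{R}^n$ with all moments finite and $\alpha!\,q_\alpha=\int_{\mathbb{R}^n} y^\alpha\,\mathrm{d}\mu(y)$ for all $\alpha\in\mathbb{N}_0^n$ (equivalently $(Tf)(x)=\int f(x+y)\,\mathrm{d}\mu(y)$ for all polynomials $f$). A measure $\mu$ on $\mathbb{R}^n$ is infinitely divisible if for every $k\in\mathbb{N}$ there is a measure $\nu$ on $\mathbb{R}^n$ with $\mu=\nu^{*k}$, the $k$-fold convolution of $\nu$ with itself. *)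

(* Defs.v *)
From HB Require Import structures.
From mathcomp Require Import all_boot all_order all_algebra.
From mathcomp.multinomials Require ssrcomplements.
(* The notations of mpoly clash with those of mathcomp-analysis. *)
From mathcomp Require Export -(notations) mpoly.
From mathcomp Require Export all_classical all_reals all_analysis.

Set Implicit Arguments.
Unset Strict Implicit.
Unset Printing Implicit Defensive.

Import Order.TTheory GRing.Theory Num.Theory.
Import numFieldNormedType.Exports.

Local Open Scope classical_set_scope.
Local Open Scope ring_scope.

(* [q : fps n R] stands for the formal power series
   \sum_(a in N_0^n) (q a) d^a in R[[d_1, ..., d_n]]. *)
Definition fps (n : nat) (R : Type) : Type := multinom n -> R.

Section FormalOperators.
Variables (n : nat) (R : realType).
Implicit Types (q A B : fps n R) (p : mpoly n R) (a : multinom n).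

Definition fps_one : fps n R := fun a => (a == mnm0)%:R.

Definition fps_scale (t : R) A : fps n R := fun a => t * A a.

(* Cauchy product: the sum is over all b with b <= a componentwise, any such b
   having total degree at most that of a. *)
Definition fps_mul A B : fps n R := fun a =>
  \sum_(b : bmultinom n (mdeg a).+1 | mpoly.lem b a) A b * B (mnm_sub a b).

Definition fps_pow A (k : nat) : fps n R := iter k (fps_mul A) fps_one.

Definition fps_exp A : fps n R := fun a =>
  limn (series (fun k : nat => fps_pow A k a / k`!%:R)).

Lemma fps_pow_eq0 A (k : nat) a : A mnm0 = 0 -> (mdeg a < k)%N ->
  fps_pow A k a = 0.
Proof.
move=> A0; elim: k a => [//|k IH] a ak; rewrite /fps_pow/= /fps_mul big1// => b.
move=> /mnm_lepP ba; have [->|b0] := eqVneq (b : multinom n) mnm0.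
  by rewrite A0 mul0r.
rewrite -/(fps_pow A k) IH ?mulr0//.
have ab : (mdeg (mnm_sub a b) + mdeg b)%N = mdeg a.
  by rewrite -mdegD submK//; apply/mnm_lepP.
have b_gt0 : (0 < mdeg b)%N by rewrite lt0n mdeg_eq0.
apply: (@leq_trans (mdeg a)) => //.
by rewrite -addn1 -[X in (_ <= X)%N]ab leq_add2l.
Qed.

(* The limit in [fps_exp] exists, and is a finite sum. *)
Lemma fps_expE A a : A mnm0 = 0 ->
  fps_exp A a = \sum_(0 <= k < (mdeg a).+1) fps_pow A k a / k`!%:R.
Proof.
move=> A0; apply/cvg_lim => //; apply: cvg_near_cst.
exists (mdeg a).+1 => //= N aN.
rewrite /series/= (@big_cat_nat _ _ _ (mdeg a).+1)//=.
rewrite [X in _ + X]big1_seq ?addr0// => k /andP[_].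
by rewrite mem_index_iota => /andP[ak _]; rewrite fps_pow_eq0 ?mul0r.
Qed.

(* For |b| >= mmeasure mdeg p = deg p + 1, the derivative d^b p vanishes. *)
Definition fps_act q p : mpoly n R :=
  \sum_(b : bmultinom n (mmeasure mdeg p)) q b *: mderivm b p.

Lemma fps_act_widen q p (k : nat) : (mmeasure mdeg p <= k)%N ->
  fps_act q p = \sum_(b : bmultinom n k) q b *: mderivm b p.
Proof.
move=> le_pk.
have vanish b : (mmeasure mdeg p <= mdeg b)%N -> mderivm b p = 0.
  move=> le_pb; apply/mpolyP => m; rewrite mcoeff_mderivm mcoeff0.
  rewrite memN_msupp_eq0 ?mul0rn//; apply: msize_mdeg_ge.
  by rewrite mdegD (leq_trans le_pb)// leq_addr.
apply: (@ssrcomplements.eq_big_widen _ _ _ _ _ _ (bmultinom n (mmeasure mdeg p))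
  (bmultinom n k) predT (fun b => q b *: mderivm b p)) => [b|b].
  by move=> /leq_trans; apply.
by rewrite -leqNgt => /vanish ->; rewrite scaler0.
Qed.

Lemma fps_act_is_linear q : linear (fps_act q).
Proof.
move=> c p1 p2.
pose k := maxn (mmeasure mdeg (c *: p1 + p2))
  (maxn (mmeasure mdeg p1) (mmeasure mdeg p2)).
rewrite !(@fps_act_widen q _ k) ?leq_max ?leqnn ?orbT//.
rewrite scaler_sumr -big_split /=; apply: eq_bigr => b _.
by rewrite linearP scalerDr !scalerA mulrC.
Qed.

HB.instance Definition _ q :=
  GRing.isLinear.Build R (mpoly n R) (mpoly n R) _ (fps_act q)
    (fps_act_is_linear q).

Definition frakD : set (fps n R) := [set q | q mnm0 = 1].

Definition frakd : set (fps n R) := [set q | q mnm0 = 0].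

Definition Pos : set (mpoly n R) :=
  [set p | forall x : 'I_n -> R, 0 <= meval x p].

Definition positivity_preserver (T : {linear mpoly n R -> mpoly n R}) : Prop :=
  T @` Pos `<=` Pos.

Definition frakD_plus : set (fps n R) :=
  [set q | frakD q /\ positivity_preserver (fps_act q)].

Definition frakd_plus : set (fps n R) :=
  [set A | frakd A /\
           forall t : R, 0 <= t -> frakD_plus (fps_exp (fps_scale t A))].

End FormalOperators.

(* R^n with its Borel sigma-algebra. *)
Definition borel_rV (n : nat) (R : realType) :=
  g_sigma_algebraType (@open 'rV[R]_n).

Section Measures.
Variables (n : nat) (R : realType).

Definition monomial (a : multinom n) (y : 'rV[R]_n) : R :=
  \prod_(i < n) y 0 i ^+ a i.

Definition representing_measure (q : fps n R)
    (mu : {measure set (borel_rV n R) -> \bar R}) : Prop :=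
  forall a : multinom n,
    mu.-integrable [set: borel_rV n R] (fun y => (monomial a y)%:E) /\
    (\int[mu]_y (monomial a y)%:E =
      ((\prod_(i < n) (a i)`!)%:R * q a)%:E)%E.

(* (mu * nu)(E) = \int mu(E - y) dnu(y).  This is stated for set functions so
   that it can be iterated without proving that the result is a measure. *)
Definition convolution (mu nu : set (borel_rV n R) -> \bar R)
    (E : set (borel_rV n R)) : \bar R :=
  (\int[nu]_y mu [set x | E ((x : 'rV[R]_n) + (y : 'rV[R]_n))%R])%E.

Definition convolution_pow (nu : set (borel_rV n R) -> \bar R) (k : nat) :
    set (borel_rV n R) -> \bar R :=
  iter k (convolution^~ nu) (dirac ((0 : 'rV[R]_n) : borel_rV n R)).

Definition infinitely_divisible
    (mu : {measure set (borel_rV n R) -> \bar R}) : Prop :=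
  forall k : nat, (0 < k)%N ->
    exists nu : {measure set (borel_rV n R) -> \bar R},
      forall E : set (borel_rV n R), measurable E ->
        mu E = convolution_pow nu k E.

Definition has_infdiv_representing_measure (q : fps n R) : Prop :=
  exists mu : {measure set (borel_rV n R) -> \bar R},
    representing_measure q mu /\ infinitely_divisible mu.

End Measures.

(* Main.v *)
(** Suppose that [exp (t A)] preserves positivity for all [t >= 0]. The moment
    problem may be indeterminate, so convolution roots have to be chosen
    coherently. By M. Riesz' extension theorem, [p |-> (exp (A / m!) p) (0)]
    extends to a positive functional on all functions dominated by polynomials;
    composed with translations, it yields an operator [T m] that commutes with
    translations and agrees with [exp (A / m!)] on polynomials. For fixed [k], the
    powers [T m ^ (m! / k)] all agree with [exp (A / k)] on polynomials, hence are
    uniformly tight, and their limits [S k] along an ultrafilter in [m] satisfy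
    [S k ^ k = S 1] on bounded Lipschitz functions. On continuous functions,
    [f |-> (S k f) (0)] is integration against a probability measure [nu k], the
    law under Lebesgue measure on [0, 1) of a limit of step functions: finer and
    finer finite partitions of R^n are coded by nested partitions of [0, 1) into
    intervals. Then [nu 1] represents [exp A] and is the k-fold convolution power
    of [nu k].

    Conversely, if a k-fold convolution power of [nu] represents [exp (t A)], then
    [nu] has finite moments and represents some [q] in D with
    [q ^ k = exp (t A)]. As k-th roots in D are unique, [q = exp ((t / k) A)].
    Hence [exp ((j t / k) A)] preserves positivity for all [j] and [k > 0], and so
    does [exp (s A)] for all [s >= 0] by continuity. *)

From HB Require Import structures.
Require Import Defs.
From mathcomp Require Import all_boot all_order all_algebra.
From mathcomp Require Import all_classical all_reals all_analysis.
From mathcomp Require Import measurable_realfun.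
From mathcomp Require Import ring lra.
Set Implicit Arguments.
Unset Strict Implicit.
Unset Printing Implicit Defensive.
Import Order.TTheory GRing.Theory Num.Theory.
Import numFieldNormedType.Exports.
Local Open Scope classical_set_scope.
Local Open Scope ring_scope.

(** * Differential operators of infinite order on polynomials *)

Section Algebra.
Variables (n : nat) (R : realType).
Implicit Types (q r A B : fps n R) (p P : mpoly n R) (a b m : multinom n).

Definition shiftp (x : 'I_n -> R) p : mpoly n R :=
  comp_mpoly [tuple mpolyX R (mnm1 i) + mpolyC n (x i) | i < n] p.

Lemma meval_shiftp x y p :
  meval y (shiftp x p) = meval (fun i => y i + x i) p.
Proof.
rewrite /shiftp comp_mpoly_meval; apply: meval_eq => i.
by rewrite tnth_mktuple mevalD mevalXU mevalC.
Qed.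

Lemma mpoly_ring_ind (S : mpoly n R -> Prop) :
  (forall c, S (mpolyC n c)) -> (forall j, S (mpolyX R (mnm1 j))) ->
  (forall p1 p2, S p1 -> S p2 -> S (p1 + p2)) ->
  (forall p1 p2, S p1 -> S p2 -> S (p1 * p2)) -> forall p, S p.
Proof.
move=> SC SX SD SM; have SXm m : S (mpolyX R m).
  rewrite mpolyXE_id; apply: (big_ind S) => //; first by rewrite -mpolyC1.
  move=> j _; elim: (m j) => [|k IH]; first by rewrite expr0 -mpolyC1.
  by rewrite exprS; apply: SM.
elim/mpolyind => [|c m p _ _ IH]; first by rewrite -mpolyC0.
by rewrite -mul_mpolyC; apply: SD => //; apply: SM.
Qed.

Lemma mderiv_shiftp i x p : mderiv i (shiftp x p) = shiftp x (mderiv i p).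
Proof.
elim/mpoly_ring_ind: p => [c|j|p1 p2 h1 h2|p1 p2 h1 h2].
- by rewrite /shiftp comp_mpolyC !mderivC comp_mpoly0.
- rewrite /shiftp comp_mpolyXU -tnth_nth tnth_mktuple.
  rewrite mderivD mderivC addr0 mderivX mnm1E.
  have [->|_] := eqVneq j i; last by rewrite !scale0r comp_mpoly0.
  by rewrite comp_mpolyZ -[X in mnm_sub X _]add0m addmK mpolyX0 comp_mpoly1.
- by rewrite /shiftp !(comp_mpolyD, mderivD) -!/(shiftp x _) h1 h2.
- rewrite /shiftp mderivM comp_mpolyD !rmorphM /= mderivM.
  by rewrite -!/(shiftp x _) h1 h2.
Qed.

Lemma mderivm_shiftp b x p : mderivm b (shiftp x p) = shiftp x (mderivm b p).
Proof.
rewrite !mderivm_foldr; elim: (flatten _) => //= i s ->.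
exact: mderiv_shiftp.
Qed.

(** Constant-coefficient differential operators commute with translations. This lets a functional at
    the single point 0 determine a whole operator. *)
Lemma fps_act_shiftp q x p : fps_act q (shiftp x p) = shiftp x (fps_act q p).
Proof.
pose k := maxn (mmeasure mdeg p) (mmeasure mdeg (shiftp x p)).
rewrite !(@fps_act_widen _ _ _ _ k) ?leq_maxl ?leq_maxr//.
rewrite /shiftp raddf_sum; apply: eq_bigr => b _ /=.
by rewrite comp_mpolyZ -!/(shiftp x _) mderivm_shiftp.
Qed.

Lemma meval_at0 p : meval (fun=> 0) p = mcoeff mnm0 p.
Proof.
elim/mpolyind: p => [|c m p _ _ IH]; first by rewrite meval0 mcoeff0.
rewrite mevalD mevalZ mcoeffD mcoeffZ IH; congr (_ * _ + _).
rewrite mevalX mcoeffX; have [->|m0] := eqVneq m mnm0.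
  by rewrite big1// => i _; rewrite mnm0E expr0.
have [i mi] : exists i, m i != 0%N.
  apply/existsP; apply: contraR m0; rewrite negb_exists => /forallP h.
  by apply/eqP/mnmP => i; rewrite mnm0E; apply/eqP; have := h i; rewrite negbK.
by rewrite (bigD1 i)//= expr0n (negbTE mi) mul0r.
Qed.

(** The bridge to moments: a measure represents [q] when its moments are the values at 0 of the
    images of the monomials. *)
Lemma fps_actX_at0 q a : meval (fun=> 0) (fps_act q (mpolyX R a)) =
  (\prod_(i < n) (a i)`!)%:R * q a.
Proof.
rewrite meval_at0 /fps_act raddf_sum /=.
have ha : (mdeg a < mmeasure mdeg (mpolyX R a))%N by rewrite msizeX.
rewrite (bigD1 (BMultinom ha))//= big1 ?addr0.
  rewrite mcoeffZ mcoeff_mderivm addm0 mcoeffX eqxx -mulr_natl mulr1 mulrC.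
  by congr (_%:R * _); apply: eq_bigr => i _; rewrite ffactnn.
move=> b /negP bNa; rewrite mcoeffZ mcoeff_mderivm addm0 mcoeffX.
case: eqP => [ab|_]; last by rewrite mul0rn mulr0.
by exfalso; apply: bNa; apply/eqP/val_inj.
Qed.

Lemma msize_le p d : (forall a, (d <= mdeg a)%N -> mcoeff a p = 0) ->
  (mmeasure mdeg p <= d)%N.
Proof.
move=> h; rewrite msizeE; apply/bigmax_leqP_seq => m mp _.
by rewrite ltnNge; apply: contraL mp => /h pm0; rewrite mcoeff_msupp pm0 eqxx.
Qed.

Lemma mcoeff_fps_act q p a :
  mcoeff a (fps_act q p) =
  \sum_(b : bmultinom n (mmeasure mdeg p))
    q b * (mcoeff (mnm_add b a) p *+ \prod_(i < n) (mnm_add b a) i ^_ b i).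
Proof.
rewrite /fps_act raddf_sum; apply: eq_bigr => b _ /=.
by rewrite mcoeffZ mcoeff_mderivm.
Qed.

Lemma mcoeff_big p a : (mmeasure mdeg p <= mdeg a)%N -> mcoeff a p = 0.
Proof. by move=> h; rewrite memN_msupp_eq0//; exact: msize_mdeg_ge. Qed.

Lemma msize_fps_act q p : (mmeasure mdeg (fps_act q p) <= mmeasure mdeg p)%N.
Proof.
apply: msize_le => a pa; rewrite mcoeff_fps_act big1// => b _.
by rewrite mcoeff_big ?mul0rn ?mulr0// mdegD (leq_trans pa)// leq_addl.
Qed.

(** The term of index 0 is the identity and all the others lower the degree. *)
Lemma fps_act_unipotent q p d : q mnm0 = 1 -> (mmeasure mdeg p <= d.+1)%N ->
  (mmeasure mdeg (fps_act q p - p) <= d)%N.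
Proof.
move=> q0 pd; have [->|p0] := eqVneq p 0.
  by rewrite linear0 subr0 msize0.
have pd' : (0 < mmeasure mdeg p)%N by rewrite lt0n msize_poly_eq0.
apply: msize_le => a da; rewrite mcoeffB mcoeff_fps_act.
have h0 : (mdeg (mnm0 : multinom n) < mmeasure mdeg p)%N by rewrite mdeg0.
rewrite (bigD1 (BMultinom h0))//= [X in _ + X - _]big1 ?addr0.
  rewrite q0 mul1r add0m big1 ?mulr1n ?subrr// => i _.
  by rewrite mnm0E ffactn0.
move=> b b0; rewrite mcoeff_big ?mul0rn ?mulr0// (leq_trans pd)// mdegD.
rewrite -add1n leq_add// lt0n mdeg_eq0; apply: contraNneq b0 => b0.
exact/eqP/val_inj.
Qed.

(** Polynomials in the derivations act through the same [fps_act]. Truncating a series to such a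
    polynomial reduces composition and commutation of operators to the commutative ring [mpoly]. *)
Definition fps_of_mpoly P : fps n R := fun a => mcoeff a P.

Definition fps_trunc (K : nat) q : mpoly n R :=
  \sum_(b : bmultinom n K) q b *: mpolyX R b.

Lemma mcoeff_fps_trunc K q a : (mdeg a < K)%N -> mcoeff a (fps_trunc K q) = q a.
Proof.
move=> aK; rewrite /fps_trunc raddf_sum (bigD1 (BMultinom aK))//= big1 ?addr0.
  by rewrite mcoeffZ mcoeffX eqxx mulr1.
move=> b ba; rewrite mcoeffZ mcoeffX (_ : (b == a :> multinom n) = false) ?mulr0//.
by apply/negbTE; apply: contraNneq ba => ba; apply/eqP/val_inj.
Qed.

Lemma fps_act_eq q r p :
  (forall a, (mdeg a < mmeasure mdeg p)%N -> q a = r a) ->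
  fps_act q p = fps_act r p.
Proof.
move=> h; apply: eq_bigr => b _; congr (_ *: _); apply: h; exact: bmdeg.
Qed.

Lemma fps_act_mpolyX m p : fps_act (fps_of_mpoly (mpolyX R m)) p = mderivm m p.
Proof.
pose K := maxn (mmeasure mdeg p) (mdeg m).+1.
rewrite (@fps_act_widen _ _ _ _ K) ?leq_maxl//.
have mK : (mdeg m < K)%N by rewrite /K leq_maxr.
rewrite (bigD1 (BMultinom mK))//= big1 ?addr0.
  by rewrite /fps_of_mpoly mcoeffX eqxx scale1r.
move=> b bm; rewrite /fps_of_mpoly mcoeffX.
rewrite (_ : (m == b :> multinom n) = false) ?scale0r//.
by apply/negbTE; apply: contraNneq bm => bm; apply/eqP/val_inj.
Qed.

Lemma fps_act_mpolyD c P1 P2 p :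
  fps_act (fps_of_mpoly (c *: P1 + P2)) p =
  c *: fps_act (fps_of_mpoly P1) p + fps_act (fps_of_mpoly P2) p.
Proof.
rewrite /fps_act scaler_sumr -big_split/=; apply: eq_bigr => b _.
by rewrite /fps_of_mpoly mcoeffD mcoeffZ scalerDl scalerA.
Qed.

Lemma fps_act_mpoly0 p : fps_act (fps_of_mpoly 0) p = 0.
Proof. by rewrite /fps_act big1// => b _; rewrite /fps_of_mpoly mcoeff0 scale0r. Qed.

Lemma fps_act_mpolyM P1 P2 p : fps_act (fps_of_mpoly (P1 * P2)) p =
  fps_act (fps_of_mpoly P1) (fps_act (fps_of_mpoly P2) p).
Proof.
elim/mpolyind: P1 => [|c m P1 _ _ IH]; first by rewrite mul0r !fps_act_mpoly0.
rewrite mulrDl -scalerAl !fps_act_mpolyD {}IH; congr (_ *: _ + _).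
rewrite fps_act_mpolyX.
elim/mpolyind: P2 => [|d m' P2 _ _ IH].
  by rewrite mulr0 !fps_act_mpoly0 linear0.
rewrite mulrDr -scalerAr !fps_act_mpolyD {}IH mderivmD mderivmZ.
by rewrite -mpolyXD !fps_act_mpolyX addmC mderivmDm.
Qed.

Lemma fps_act_trunc K q p : (mmeasure mdeg p <= K)%N ->
  fps_act (fps_of_mpoly (fps_trunc K q)) p = fps_act q p.
Proof.
move=> pK; apply: fps_act_eq => a ap; rewrite /fps_of_mpoly mcoeff_fps_trunc//.
exact: leq_trans pK.
Qed.

(** On a polynomial of size K only coefficients of degree below K act, so both factors may be
    truncated; the Cauchy product then becomes a product of polynomials. *)
Lemma fps_act_mul A B p : fps_act (fps_mul A B) p = fps_act A (fps_act B p).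
Proof.
pose K := mmeasure mdeg p.
rewrite -[RHS](@fps_act_trunc K) ?msize_fps_act//.
rewrite -(@fps_act_trunc K B)// -fps_act_mpolyM.
apply: fps_act_eq => a aK; rewrite /fps_of_mpoly.
rewrite (@mcoeff_poly_mul_lin _ _ _ _ _ (mdeg a).+1)//.
apply: eq_bigr => b /mnm_lepP ba.
have ab : (mdeg (mnm_sub a b) + mdeg b)%N = mdeg a.
  by rewrite -mdegD submK//; apply/mnm_lepP.
have [h1 h2] : (mdeg b <= mdeg a)%N /\ (mdeg (mnm_sub a b) <= mdeg a)%N.
  by split; [apply: leq_trans (eq_leq ab); exact: leq_addl
            |apply: leq_trans (eq_leq ab); exact: leq_addr].
by rewrite !mcoeff_fps_trunc// (leq_ltn_trans _ aK).
Qed.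

Lemma fps_act_comm q r p : fps_act q (fps_act r p) = fps_act r (fps_act q p).
Proof.
pose K := mmeasure mdeg p.
rewrite -(@fps_act_trunc K r p)// -(@fps_act_trunc K q p)//.
rewrite -(@fps_act_trunc K q) ?msize_fps_act//.
rewrite -[in RHS](@fps_act_trunc K r) ?msize_fps_act//.
by rewrite -!fps_act_mpolyM mulrC.
Qed.

Lemma fps_act_one p : fps_act (@fps_one n R) p = p.
Proof.
rewrite -[RHS]mderivm0m -fps_act_mpolyX; apply: fps_act_eq => a _.
by rewrite /fps_one /fps_of_mpoly mcoeffX eq_sym.
Qed.

Lemma fps_act_pow A k p : fps_act (fps_pow A k) p = iter k (fps_act A) p.
Proof.
elim: k => [|k IH]; first exact: fps_act_one.
by rewrite /fps_pow !iterS -/(fps_pow A k) fps_act_mul IH.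
Qed.

Lemma iter_fps_act_eq0 A k p : A mnm0 = 0 -> (mmeasure mdeg p <= k)%N ->
  iter k (fps_act A) p = 0.
Proof.
move=> A0 pk; rewrite -fps_act_pow -[RHS](fps_act_mpoly0 p).
apply: fps_act_eq => a ap; rewrite fps_pow_eq0 ?/fps_of_mpoly ?mcoeff0//.
exact: leq_trans pk.
Qed.

Lemma fps_pow_scale (t : R) A k a :
  fps_pow (fps_scale t A) k a = t ^+ k * fps_pow A k a.
Proof.
elim: k a => [|k IH] a; first by rewrite expr0 mul1r.
rewrite /fps_pow !iterS -!/(fps_pow _ _) /fps_mul big_distrr/=.
by apply: eq_bigr => b _; rewrite IH /fps_scale exprS; ring.
Qed.

Lemma fps_exp_scaleE (t : R) A a (K : nat) : A mnm0 = 0 -> (mdeg a < K)%N ->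
  fps_exp (fps_scale t A) a = \sum_(k < K) t ^+ k / k`!%:R * fps_pow A k a.
Proof.
move=> A0 aK; rewrite fps_expE; last by rewrite /fps_scale A0 mulr0.
rewrite -(big_mkord xpredT (fun k => t ^+ k / k`!%:R * fps_pow A k a)).
rewrite [RHS](@big_cat_nat _ _ _ (mdeg a).+1)//= [X in _ + X]big1_seq ?addr0.
  by apply: eq_bigr => k _; rewrite fps_pow_scale mulrAC.
by move=> k; rewrite mem_index_iota => /andP[_ /andP[ak _]]; rewrite fps_pow_eq0 ?mulr0.
Qed.

Lemma fps_exp0 (t : R) A : A mnm0 = 0 -> fps_exp (fps_scale t A) mnm0 = 1.
Proof.
move=> A0; rewrite (@fps_exp_scaleE _ _ _ 1) ?mdeg0// big_ord1.
by rewrite expr0 fact0 divr1 mul1r /fps_pow/= /fps_one eqxx.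
Qed.

Lemma fps_act_exp (t : R) A p K : A mnm0 = 0 -> (mmeasure mdeg p <= K)%N ->
  fps_act (fps_exp (fps_scale t A)) p =
  \sum_(k < K) (t ^+ k / k`!%:R) *: iter k (fps_act A) p.
Proof.
move=> A0 pK; under [RHS]eq_bigr do rewrite -fps_act_pow /fps_act scaler_sumr.
rewrite exchange_big/=; apply: eq_bigr => b _.
rewrite (@fps_exp_scaleE _ _ _ K)//; last exact: leq_trans (bmdeg b) pK.
by rewrite scaler_suml; apply: eq_bigr => k _; rewrite scalerA.
Qed.

(** The product of two exponential sums, all of them finite because [A] lowers the degree. *)
Lemma fps_act_exp_add (s t : R) A p : A mnm0 = 0 ->
  fps_act (fps_exp (fps_scale s A)) (fps_act (fps_exp (fps_scale t A)) p) =
  fps_act (fps_exp (fps_scale (s + t) A)) p.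
Proof.
move=> A0; set K := mmeasure mdeg p.
rewrite (@fps_act_exp _ _ _ K)// ?msize_fps_act//.
rewrite !(@fps_act_exp _ _ p K)//.
have iterD k : {morph iter k (fps_act A) : x y / x + y}.
  by move=> x y; elim: k => //= k ->; rewrite linearD.
have iterZ k c x : iter k (fps_act A) (c *: x) = c *: iter k (fps_act A) x.
  by elim: k => //= k ->; rewrite linearZ.
have iter0 k : iter k (fps_act A) 0 = 0 by elim: k => //= k ->; rewrite linear0.
transitivity (\sum_(i < K) \sum_(j < K)
   ((s ^+ i * t ^+ j) / (i`!%:R * j`!%:R)) *: iter (i + j) (fps_act A) p).
  apply: eq_bigr => i _; rewrite (big_morph _ (iterD i) (iter0 i)) scaler_sumr.
  apply: eq_bigr => j _; rewrite iterZ scalerA -ssrnat.iterD; congr (_ *: _).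
  by rewrite invfM; ring.
(* Regroup by k = i + j; pairs with i + j >= K contribute nothing, as so many applications of [A]
   kill [p]. *)
transitivity (\sum_(k < K) \sum_(i < K | (i <= k)%N)
   ((s ^+ i * t ^+ (k - i)) / (i`!%:R * (k - i)`!%:R)) *: iter k (fps_act A) p).
  rewrite [RHS](exchange_big_dep xpredT)//=; apply: eq_bigr => i _.
  transitivity (\sum_(i <= k < K) ((s ^+ i * t ^+ (k - i)) /
    (i`!%:R * (k - i)`!%:R)) *: iter k (fps_act A) p); last by rewrite big_geq_mkord.
  rewrite -[X in \sum_(X <= _ < _) _]add0n big_addn.
  rewrite -(big_mkord xpredT (fun j => ((s ^+ i * t ^+ j) /
    (i`!%:R * j`!%:R)) *: iter (i + j) (fps_act A) p)).
  rewrite (@big_cat_nat _ _ _ (K - i))//=; last exact: leq_subr.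
  rewrite [X in _ + X]big1_seq ?addr0.
    by apply: eq_bigr => j _; rewrite addnK addnC.
  move=> j; rewrite mem_index_iota => /andP[_ /andP[ij _]].
  by rewrite iter_fps_act_eq0 ?scaler0// -leq_subLR.
(* The inner sum is (s + t)^k / k! by the binomial theorem. *)
apply: eq_bigr => k _; rewrite -scaler_suml; congr (_ *: _).
rewrite addrC exprDn big_distrl/= (big_ord_widen_cond K xpredT (fun i =>
  t ^+ (k - i) * s ^+ i *+ 'C(k, i) / k`!%:R))//=.
apply: eq_big => [i|i ik]; first by rewrite ltnS.
rewrite -(bin_fact ik) !natrM -mulr_natr.
have := pnatr_eq0 R; move=> P0; field.
by rewrite !P0 -!lt0n !fact_gt0 bin_gt0 ik.
Qed.

Lemma fps_act_exp_scale0 A p : A mnm0 = 0 ->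
  fps_act (fps_exp (fps_scale 0 A)) p = p.
Proof.
move=> A0; rewrite (@fps_act_exp _ _ _ (mmeasure mdeg p).+1)// big_ord_recl/=.
by rewrite expr0 fact0 divr1 scale1r big1 ?addr0// => k _; rewrite exprS !mul0r scale0r.
Qed.

Lemma fps_act_exp1 (t : R) A : A mnm0 = 0 ->
  fps_act (fps_exp (fps_scale t A)) 1 = 1.
Proof.
move=> A0; rewrite (@fps_act_exp _ _ _ 1) ?msize1// big_ord1/=.
by rewrite expr0 fact0 divr1 scale1r.
Qed.

(** Induction on the size of [p]. The error e = q p - r p has lower degree, where q and r agree by
    induction, so q^(j+1) p = r^(j+1) p + (j+1) r^j e. For j + 1 = k this gives r^(k-1) e = 0, and
    the unipotent operator r is injective. *)
Lemma fps_act_root_uniq q r k : q mnm0 = 1 -> r mnm0 = 1 -> (0 < k)%N ->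
  (forall p, iter k (fps_act q) p = iter k (fps_act r) p) ->
  forall p, fps_act q p = fps_act r p.
Proof.
move=> q0 r0 k0 qr p; move: {2}(mmeasure mdeg p) (leqnn (mmeasure mdeg p)) => d.
elim: d p => [|d IH] p pd.
  have -> : p = 0 by apply/eqP; rewrite -msize_poly_eq0 -leqn0.
  by rewrite !linear0.
pose e := fps_act q p - fps_act r p.
have ed : (mmeasure mdeg e <= d)%N.
  have -> : e = (fps_act q p - p) - (fps_act r p - p).
    by rewrite /e opprB addrA subrK.
  apply: (leq_trans (msizeD_le _ _)).
  by rewrite geq_max msizeN !fps_act_unipotent.
have iterd j f : (mmeasure mdeg f <= d)%N ->
    (mmeasure mdeg (iter j (fps_act r) f) <= d)%N.
  by elim: j => //= j IHj /IHj; apply: leq_trans; exact: msize_fps_act.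
have commr j f : fps_act q (iter j (fps_act r) f) = iter j (fps_act r) (fps_act q f).
  by elim: j => //= j <-; rewrite fps_act_comm.
have iterD j x y : iter j (fps_act r) (x + y) =
    iter j (fps_act r) x + iter j (fps_act r) y.
  by elim: j => //= j ->; rewrite linearD.
have key j : iter j.+1 (fps_act q) p =
    iter j.+1 (fps_act r) p + j.+1%:R *: iter j (fps_act r) e.
  elim: j => [|j IHj]; first by rewrite /= scale1r /e addrC subrK.
  have linq x y c : fps_act q (x + c *: y) = fps_act q x + c *: fps_act q y.
    by rewrite linearD linearZ.
  rewrite iterS IHj linq commr.
  rewrite -[fps_act q p](subrK (fps_act r p)) -/e.
  rewrite IH ?iterd// iterD -!iterSr -!iterS.
  rewrite [X in X + _]addrC -addrA -[in RHS]natr1 scalerDl scale1r.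
  by rewrite [X in _ = _ + X]addrC.
have er : iter k.-1 (fps_act r) e = 0.
  have := key k.-1; rewrite prednK// qr => /eqP.
  rewrite -subr_eq0 opprD addrA subrr sub0r oppr_eq0 scaler_eq0 pnatr_eq0.
  by rewrite -leqn0 leqNgt k0 => /eqP.
have inj f : fps_act r f = 0 -> f = 0.
  move=> rf; apply/eqP; rewrite -msize_poly_eq0; apply/negP => /negP f0.
  have := @fps_act_unipotent r f (mmeasure mdeg f).-1 r0.
  rewrite rf sub0r msizeN prednK ?lt0n// leqnn => /(_ isT).
  by rewrite -ltnS prednK ?lt0n// ltnn.
apply/eqP; rewrite -subr_eq0 -/e; apply/eqP.
by move: er; elim: (k.-1) => //= j IHj /inj.
Qed.

Lemma iter_fps_act_exp (t : R) A k p : A mnm0 = 0 ->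
  iter k (fps_act (fps_exp (fps_scale t A))) p =
  fps_act (fps_exp (fps_scale (k%:R * t) A)) p.
Proof.
move=> A0; elim: k => [|k IH]; first by rewrite mul0r fps_act_exp_scale0.
by rewrite iterS IH fps_act_exp_add// -nat1r mulrDl mul1r.
Qed.

Lemma mcoeff_mderivm_at0 b p :
  mcoeff mnm0 (mderivm b p) = (\prod_(i < n) (b i)`!)%:R * mcoeff b p.
Proof.
rewrite mcoeff_mderivm addm0 -[LHS]mulr_natl; congr (_%:R * _).
by apply: eq_bigr => i _; rewrite ffactnn.
Qed.

Lemma mderivm_fps_act b q p : mderivm b (fps_act q p) = fps_act q (mderivm b p).
Proof. by rewrite -!fps_act_mpolyX fps_act_comm. Qed.

(** Taylor expansion at 0. For operators commuting with derivatives, agreement of the values at 0 on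
    all polynomials therefore gives full agreement. *)
Lemma mpoly_eq_mderivm_at0 p P : (forall b, mcoeff mnm0 (mderivm b p) =
  mcoeff mnm0 (mderivm b P)) -> p = P.
Proof.
move=> h; apply/mpolyP => b; have := h b; rewrite !mcoeff_mderivm_at0.
apply: mulfI; rewrite pnatr_eq0 -lt0n prodn_gt0// => i; exact: fact_gt0.
Qed.

End Algebra.

(** * Positive functionals and convolution operators *)

Section PositiveExtension.
Variables (T : Type) (R : realType).
Variables (M : set (T -> R)) (L : (T -> R) -> R).
Hypothesis M0 : M (fun=> 0).
Hypothesis Mlin : forall (c : R) f g, M f -> M g -> M (fun x => c * f x + g x).
Hypothesis Llin : forall (c : R) f g, M f -> M g ->
  L (fun x => c * f x + g x) = c * L f + L g.
Hypothesis Lpos : forall f, M f -> (forall x, 0 <= f x) -> 0 <= L f.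

(** Partial functionals are encoded as graphs, that is, sets of pairs of a function and a value;
    [lin] and [pos] together make such a graph single-valued. *)
Let base : set ((T -> R) * R) := [set fa | M fa.1 /\ fa.2 = L fa.1].

Let lin (G : set ((T -> R) * R)) := forall (c : R) f a g b,
  G (f, a) -> G (g, b) -> G (fun x => c * f x + g x, c * a + b).

Let pos (G : set ((T -> R) * R)) := forall f a, G (f, a) ->
  (forall x, 0 <= f x) -> 0 <= a.

Let good G := [/\ base `<=` G, lin G & pos G].

Lemma extension_step G f : good G -> (exists2 p, M p & forall x, `|f x| <= p x) ->
  exists2 G', good G' & G `<=` G' /\ exists c, G' (f, c).
Proof.
move=> [bG lG pG] [p Mp fp].
have G0 : G (fun=> 0, 0).
  have := lG 0 _ _ _ _ (bG (p, L p) (conj Mp erefl)) (bG (p, L p) (conj Mp erefl)).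
  move=> /(lG (-1) _ _ _ _ (bG (p, L p) (conj Mp erefl))).
  by congr G; congr pair; [apply/funext => x|]; ring.
have Glin c g a h b : G (g, a) -> G (h, b) -> G (fun x => c * g x + h x, c * a + b).
  exact: lG.
have GM g : M g -> G (g, L g) by move=> Mg; apply: bG.
have Gle g a h b : G (g, a) -> G (h, b) -> (forall x, g x <= h x) -> a <= b.
  move=> Gg Gh gh; rewrite -subr_ge0 addrC -mulN1r.
  by apply: (pG _ _ (Glin (-1) _ _ _ _ Gg Gh)) => x; rewrite mulN1r addrC subr_ge0.
have Gscale c g a : G (g, a) -> G (fun x => c * g x, c * a).
  move=> Gg; have := Glin c _ _ _ _ Gg G0.
  by congr G; congr pair; [apply/funext => x|]; rewrite addr0.
(* The value given to [f] is the supremum of the values of its minorants in the graph; [p] and its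
   negative keep it finite. It lies below the value of every majorant of [f]. *)
pose S : set R := [set a | exists2 g, G (g, a) & forall x, g x <= f x].
have S0 : S !=set0.
  exists (-1 * L p), (fun x => -1 * p x); first exact/Gscale/GM.
  by move=> x; rewrite mulN1r; have := fp x; rewrite ler_norml => /andP[].
have Sub : ubound S (L p).
  move=> a [g Gg gf]; apply: (Gle _ _ _ _ Gg (GM _ Mp)) => x.
  by rewrite (le_trans (gf x))// (le_trans (ler_norm _)).
pose c := sup S.
have cub a : S a -> a <= c by move=> Sa; apply: ub_le_sup => //; exists (L p).
have cle b h : G (h, b) -> (forall x, f x <= h x) -> c <= b.
  move=> Gh fh; apply: ge_sup => // a [g Gg gf].
  by apply: (Gle _ _ _ _ Gg Gh) => x; rewrite (le_trans (gf x)).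
exists [set ga | exists g a t, [/\ G (g, a), ga.1 = (fun x => g x + t * f x)
   & ga.2 = a + t * c]]; last split.
- split.
  + move=> [g a] [/= Mg ->]; exists g, (L g), 0; split => /=; first exact: GM.
      by apply/funext => x; rewrite mul0r addr0.
    by rewrite mul0r addr0.
  + move=> d g1 a1 g2 a2 [h1 [b1 [t1 [/= Gh1 -> ->]]]] [h2 [b2 [t2 [/= Gh2 -> ->]]]].
    exists (fun x => d * h1 x + h2 x), (d * b1 + b2), (d * t1 + t2); split => /=.
    * exact: Glin.
    * by apply/funext => x; ring.
    * by ring.
  + move=> g1 a1 [g [a [t [/= Gg -> ->]]]] ge0.
    (* For t < 0, g / (-t) is a majorant of [f]; for t > 0, -g / t is a minorant. Comparing its
       value with c gives a + t c >= 0. *)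
    have [t0|t0|t0] := ltgtP t 0.
    * have -> : a + t * c = - t * ((- t)^-1 * a - c) by field; rewrite lt_eqF.
      apply: mulr_ge0; first by rewrite oppr_ge0 ltW.
      rewrite subr_ge0; apply: (cle _ _ (Gscale _ _ _ Gg)) => x.
      by rewrite ler_pdivlMl ?oppr_gt0//; have := ge0 x; lra.
    * have -> : a + t * c = t * (c - (- t^-1) * a) by field; rewrite gt_eqF.
      apply: mulr_ge0; first exact: ltW.
      rewrite subr_ge0; apply: cub; exists (fun x => (- t^-1) * g x); first exact: Gscale.
      by move=> x; rewrite mulNr lerNl ler_pdivlMl//; have := ge0 x; lra.
    * by rewrite t0 mul0r addr0; apply: (pG _ _ Gg) => x; have := ge0 x; rewrite t0 mul0r addr0.
- move=> [g a] Gg; exists g, a, 0; split => //=.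
    by apply/funext => x; rewrite mul0r addr0.
  by rewrite mul0r addr0.
- exists c, (fun=> 0), 0, 1; split => //=.
    by apply/funext => x; rewrite mul1r add0r.
  by rewrite mul1r add0r.
Qed.

Definition majorized_by (f : T -> R) := exists2 p, M p & forall x, `|f x| <= p x.

Lemma positive_extension : exists I : (T -> R) -> R, [/\
  forall f, M f -> I f = L f,
  forall (c : R) f g, majorized_by f -> majorized_by g ->
    I (fun x => c * f x + g x) = c * I f + I g &
  forall f, majorized_by f -> (forall x, 0 <= f x) -> 0 <= I f].
Proof.
pose P G := G = set0 \/ good G.
have goodbase : good base.
  split => //.
    move=> c f a g b [/= Mf ->] [/= Mg ->]; split => /=; first exact: Mlin.
    by rewrite Llin.
  by move=> f a [/= Mf ->]; exact: Lpos.
have [|G [PG Gmax]] := @Zorn_bigcup _ P.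
  move=> F FP Ftot; have [[X0 [FX0 gX0]]|noX] := pselect (exists X, F X /\ good X).
    right; split.
    - by move=> z bz; exists X0 => //; have [+ _ _] := gX0; exact.
    - move=> c f a g b [X FX Xf] [Y FY Yg].
      have gd Z z : F Z -> Z z -> good Z.
        by move=> FZ Zz; have [Z0|//] := FP _ FZ; move: Zz; rewrite Z0.
      have [XY|YX] := Ftot _ _ FX FY.
        exists Y => //; have [_ lY _] := gd _ _ FY Yg.
        by apply: lY => //; exact: XY.
      exists X => //; have [_ lX _] := gd _ _ FX Xf.
      by apply: lX => //; exact: YX.
    - move=> f a [X FX Xf]; have [X0'|[_ _ pX]] := FP _ FX; last exact: pX Xf.
      by move: Xf; rewrite X0'.
  left; rewrite -subset0 => z [X FX Xz]; have [X0|gX] := FP _ FX.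
    by move: Xz; rewrite X0.
  by case: noX; exists X.
have gG : good G.
  case: PG => // G0; exfalso; apply: (Gmax base); last by right.
  rewrite G0; split => [//|h]; have : base (fun=> 0, L (fun=> 0)) by split.
  by move=> /h.
have [bG lG pG] := gG.
have Gtot f : majorized_by f -> exists c, G (f, c).
  move=> /(extension_step gG) [G' gG' [GG' [c G'f]]].
  exists c; apply: contrapT => nG; apply: (Gmax G'); last by right.
  by split => // /(_ _ G'f).
have Guniq f a b : G (f, a) -> G (f, b) -> a = b.
  have le u v : G (f, u) -> G (f, v) -> u <= v.
    move=> Gu Gv; have := lG (-1) _ _ _ _ Gu Gv.
    move=> /pG; rewrite mulN1r addrC subr_ge0; apply=> x.
    by rewrite mulN1r addrC subrr.
  by move=> Ga Gb; apply/eqP; rewrite eq_le !le.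
pose I f := xget 0 [set c | G (f, c)].
have IG f a : G (f, a) -> I f = a.
  by move=> Ga; apply: xget_unique => // b Gb; exact: Guniq Gb Ga.
exists I; split.
- by move=> f Mf; apply: IG; apply: bG.
- move=> c f g /Gtot[a Ga] /Gtot[b Gb]; rewrite (IG _ _ Ga) (IG _ _ Gb).
  by apply: IG; apply: lG.
- by move=> f /Gtot[a Ga]; rewrite (IG _ _ Ga); exact: pG Ga.
Qed.

End PositiveExtension.

(** * Translation-invariant positive operators on functions of polynomial growth *)

Section Operators.
Variables (n : nat) (R : realType).
Implicit Types (p : mpoly n R) (x y : 'rV[R]_n) (f g : 'rV[R]_n -> R).

Definition ev p y : R := meval (y 0) p.

(** No regularity is imposed: indicators of arbitrary sets belong to the space, so that every cell
    of a partition can be given a mass. *)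
Definition dom f := exists p, forall x, `|f x| <= ev p x.

Definition translate x f y := f (y + x).

Lemma evD p1 p2 x : ev (p1 + p2) x = ev p1 x + ev p2 x.
Proof. exact: mevalD. Qed.

Lemma evZ c p x : ev (c *: p) x = c * ev p x.
Proof. exact: mevalZ. Qed.

Lemma evC c x : ev (mpolyC n c) x = c.
Proof. exact: mevalC. Qed.

Lemma ev_shiftp x p : ev (shiftp (x 0) p) = translate x (ev p).
Proof.
apply/funext => y; rewrite /ev /translate meval_shiftp.
by apply: meval_eq => i; rewrite mxE.
Qed.

Lemma Pos_ev p : (forall x, 0 <= ev p x) -> Pos p.
Proof.
move=> h x; have := h (\row_i x i); rewrite /ev.
by rewrite (@meval_eq _ _ _ x)// => i; rewrite mxE.
Qed.

Lemma dom_lin c f g : dom f -> dom g -> dom (fun x => c * f x + g x).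
Proof.
move=> [p fp] [q gq]; exists (`|c| *: p + q) => x.
rewrite evD evZ (le_trans (ler_normD _ _))// lerD// normrM.
by rewrite ler_wpM2l.
Qed.

Lemma dom_scale c f : dom f -> dom (fun x => c * f x).
Proof.
move=> [p fp]; exists (`|c| *: p) => x.
by rewrite evZ normrM ler_wpM2l.
Qed.

Lemma dom_le f g : dom g -> (forall x, `|f x| <= g x) -> dom f.
Proof.
move=> [p gp] fg; exists p => x; apply: le_trans (fg x) _.
by apply: le_trans (ler_norm _) (gp x).
Qed.

Lemma dom_ev p : dom (ev p).
Proof.
(* Uses |u| <= 1 + u^2 for real u. *)
exists (1 + p * p) => x.
have -> : ev (1 + p * p) x = 1 + ev p x * ev p x.
  by rewrite /ev mevalD meval1 mevalM.
rewrite ler_norml; have := sqr_ge0 (ev p x - 1); have := sqr_ge0 (ev p x + 1).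
have := sqr_ge0 (ev p x).
by move=> h1 h2 h3; apply/andP; split; nra.
Qed.

Lemma dom_bounded B f : (forall x, `|f x| <= B) -> dom f.
Proof. by move=> h; exists (mpolyC n B) => x; rewrite evC. Qed.

Lemma dom_norm f : dom f -> dom (fun x => `|f x|).
Proof. by move=> [p fp]; exists p => x; rewrite normr_id. Qed.

Lemma dom_translate x f : dom f -> dom (translate x f).
Proof.
by move=> [p fp]; exists (shiftp (x 0) p) => y; rewrite ev_shiftp; exact: fp.
Qed.

Definition positive_linear (J : ('rV[R]_n -> R) -> R) :=
  (forall c f g, dom f -> dom g ->
    J (fun x => c * f x + g x) = c * J f + J g) /\
  (forall f, dom f -> (forall x, 0 <= f x) -> 0 <= J f).

Section PositiveLinear.
Variable J : ('rV[R]_n -> R) -> R.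
Hypothesis HJ : positive_linear J.

Lemma positive_linear0 : J (fun=> 0) = 0.
Proof.
have d0 : dom (fun=> 0) by apply: (@dom_bounded 0) => x; rewrite normr0.
have := HJ.1 1 _ _ d0 d0.
have -> : (fun x : 'rV[R]_n => 1 * 0 + 0 : R) = (fun=> 0) by apply/funext => x; ring.
lra.
Qed.

Lemma positive_linearZ c f : dom f -> J (fun x => c * f x) = c * J f.
Proof.
have d0 : dom (fun=> 0) by apply: (@dom_bounded 0) => x; rewrite normr0.
move=> df; have := HJ.1 c _ _ df d0; rewrite positive_linear0 addr0 => <-.
by congr J; apply/funext => x; rewrite addr0.
Qed.

Lemma positive_linearD f g : dom f -> dom g -> J (fun x => f x + g x) = J f + J g.
Proof.
move=> df dg; have := HJ.1 1 _ _ df dg; rewrite mul1r => <-.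
by congr J; apply/funext => x; rewrite mul1r.
Qed.

Lemma positive_linearB f g : dom f -> dom g -> J (fun x => f x - g x) = J f - J g.
Proof.
move=> df dg; have := HJ.1 (-1) _ _ dg df; rewrite mulN1r addrC => <-.
by congr J; apply/funext => x; rewrite mulN1r addrC.
Qed.

Lemma dom_sub f g : dom f -> dom g -> dom (fun x => f x - g x).
Proof.
move=> df dg; have := dom_lin (-1) dg df.
by congr dom; apply/funext => x; rewrite mulN1r addrC.
Qed.

Lemma positive_linear_le f g : dom f -> dom g -> (forall x, f x <= g x) -> J f <= J g.
Proof.
move=> df dg fg; rewrite -subr_ge0 -positive_linearB//.
by apply: HJ.2 => [|x]; [exact: dom_sub|rewrite subr_ge0].
Qed.

Lemma positive_linear_norm f g : dom f -> dom g -> (forall x, `|f x| <= g x) ->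
  `|J f| <= J g.
Proof.
move=> df dg fg; rewrite ler_norml -mulN1r -positive_linearZ//.
apply/andP; split; apply: positive_linear_le => //.
- exact: dom_scale.
- by move=> x; have := fg x; rewrite ler_norml mulN1r => /andP[].
- by move=> x; have := fg x; rewrite ler_norml => /andP[].
Qed.

End PositiveLinear.

(** Convolution operators without a measure: positive, translation-invariant, and acting on
    polynomials as [Q]. Unlike functionals at one point they can be composed, so powers and roots
    make sense. *)
Definition posop (S : ('rV[R]_n -> R) -> 'rV[R]_n -> R) (Q : mpoly n R -> mpoly n R) :=
  [/\ forall x, positive_linear (S^~ x),
      forall x f, S (translate x f) = translate x (S f) &
      forall p, S (ev p) = ev (Q p)].

Lemma posop_norm S Q f p x : posop S Q -> (forall x, `|f x| <= ev p x) ->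
  `|S f x| <= ev (Q p) x.
Proof.
move=> [hp _ hQ] fp; rewrite -hQ.
apply: (positive_linear_norm (hp x)) => //; [by exists p | exact: dom_ev].
Qed.

Lemma posop_dom S Q f : posop S Q -> dom f -> dom (S f).
Proof. by move=> SQ [p fp]; exists (Q p) => x; exact: posop_norm. Qed.

Lemma posop_id : posop id id.
Proof. by split => // x; split. Qed.

Lemma posop_comp S1 Q1 S2 Q2 : posop S1 Q1 -> posop S2 Q2 ->
  posop (S1 \o S2) (Q1 \o Q2).
Proof.
move=> h1 h2; have [p1 s1 e1] := h1; have [p2 s2 e2] := h2; split => [x|x f|p] /=.
- split => [c f g df dg|f df f0] /=.
    have -> : S2 (fun x => c * f x + g x) = (fun x => c * S2 f x + S2 g x).
      by apply/funext => y; rewrite (p2 y).1.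
    by rewrite (p1 x).1//; exact: posop_dom.
  by apply: (p1 x).2 => [|y]; [exact: posop_dom|exact: (p2 y).2].
- by rewrite s2 s1.
- by rewrite e2 e1.
Qed.

Lemma posop_iter S Q k : posop S Q -> posop (iter k S) (iter k Q).
Proof.
move=> SQ; elim: k => [|k IH]; first exact: posop_id.
exact: (posop_comp SQ IH).
Qed.

Lemma eq_posop S Q Q' : (forall p, Q p = Q' p) -> posop S Q -> posop S Q'.
Proof. by move=> QQ [a b c]; split => // p; rewrite c QQ. Qed.

(** The functional p |-> (q p)(0) extends to some [I] on all dominated functions; the operator sends
    f to x |-> I (f (. + x)). It agrees with [fps_act q] on polynomials because the latter commutes
    with translations. *)
Lemma posop_exists (q : fps n R) : positivity_preserver (fps_act q) ->
  exists S, posop S (fps_act q).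
Proof.
move=> qpos; have evpos p : (forall x, 0 <= ev p x) -> forall x, 0 <= ev (fps_act q p) x.
  by move=> /Pos_ev Pp x; apply: qpos; exists p.
pose M := [set f | exists p, f = ev p].
(* The functional is defined on functions through a chosen polynomial; positivity of the operator
   shows that the choice does not matter. *)
pose L f := xget 0 [set v | exists2 p, f = ev p & v = ev (fps_act q p) 0].
have LE p : L (ev p) = ev (fps_act q p) 0.
  apply: xget_unique; first by exists p.
  move=> _ [p' pp' ->].
  have le p1 p2 : ev p1 = ev p2 -> ev (fps_act q p1) 0 <= ev (fps_act q p2) 0.
    move=> e; have := @evpos (p2 - p1).
    rewrite linearB/= => h; rewrite -subr_ge0; have := h _ 0.
    rewrite /ev !mevalB; apply => x; rewrite /ev mevalB.
    by have := congr1 (fun f => f x) e; rewrite /ev => ->; rewrite subrr.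
  by apply/eqP; rewrite eq_le !le.
have evlin c p1 p2 : (fun x => c * ev p1 x + ev p2 x) = ev (c *: p1 + p2).
  by apply/funext => x; rewrite evD evZ.
have [||||I [IM Ilin Ipos]] := @positive_extension _ R M L.
- by exists 0; apply/funext => x; rewrite /ev meval0.
- by move=> c _ _ [p1 ->] [p2 ->]; exists (c *: p1 + p2); rewrite evlin.
- by move=> c _ _ [p1 ->] [p2 ->]; rewrite evlin !LE linearP evD evZ.
- by move=> _ [p ->] p0; rewrite LE; exact: evpos.
have domM f : dom f -> majorized_by M f.
  by move=> [p fp]; exists (ev p) => //; exists p.
exists (fun f x => I (translate x f)); split => [x|x f|p].
- split => [c f g df dg|f df f0].
    by rewrite -Ilin//; apply: domM; exact: dom_translate.
  by apply: Ipos => [|y]; [apply: domM; exact: dom_translate|exact: f0].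
- by apply/funext => y; rewrite /translate; congr I; apply/funext => z; rewrite addrA.
- apply/funext => x; rewrite -ev_shiftp IM; last by exists (shiftp (x 0) p).
  rewrite LE fps_act_shiftp ev_shiftp /translate add0r.
  by [].
Qed.

End Operators.

(** * Limits along an ultrafilter *)

Section Ultralimit.
Variables (n : nat) (R : realType).
Variable U : set_system nat.
Hypothesis UU : UltraFilter U.
Implicit Types (p : mpoly n R) (x y : 'rV[R]_n) (f g : 'rV[R]_n -> R).

(** A segment is compact, so the image ultrafilter has a cluster point, and an ultrafilter converges
    to each of its cluster points. *)
Lemma ultra_cvg (u : nat -> R) B : (\forall m \near U, `|u m| <= B) -> cvg (u @ U).
Proof.
move=> uB; have [|a [_ ua]] := @segment_compact R (- B) B (u @ U) _.
  by near=> m; rewrite /= in_itv/= -ler_norml; near: m.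
apply/cvg_ex; exists a => A nA.
have [//|nUA] := in_ultra_setVsetC (u @^-1` A) UU.
by have [z [nAz]] := ua (~` A) A nUA nA.
Unshelve. all: by end_near. Qed.

Variables (W : nat -> ('rV[R]_n -> R) -> 'rV[R]_n -> R) (Q : mpoly n R -> mpoly n R).
Hypothesis WQ : \forall m \near U, posop (W m) Q.

Definition ulim f x : R := lim (W m f x @[m --> U]).

(** Since the [W m] act alike on polynomials, [ev (Q p) x] bounds the values for almost all m at
    once. *)
Lemma cvg_ulim f x : dom f -> W m f x @[m --> U] --> ulim f x.
Proof.
move=> [p fp]; apply: (@ultra_cvg _ (ev (Q p) x)); near=> m.
by apply: posop_norm => //; near: m.
Unshelve. all: by end_near. Qed.

Lemma posop_ulim : posop ulim Q.
Proof.
split => [x|x f|p].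
- split => [c f g df dg|f df f0].
    apply/cvg_lim => //.
    apply: (@cvg_trans _ (c * W m f x + W m g x @[m --> U])).
      apply: near_eq_cvg; near=> m.
      have [+ _ _] : posop (W m) Q by near: m.
      by move=> /(_ x)[-> ].
    by apply: cvgD; [apply: cvgM (cvg_cst _) _; exact: cvg_ulim|exact: cvg_ulim].
  have hc := @cvg_ulim f x df; rewrite /=; apply: (cvgr_to_ge hc); near=> m.
  have [+ _ _] : posop (W m) Q by near: m.
  by move=> /(_ x)[_ ]; apply.
- apply/funext => y; rewrite /ulim /translate; congr (lim _).
  apply/seteqP; split => A.
    apply: filterS2 WQ => m [_ + _] /=; by move=> /(_ x f) e; rewrite -/(translate x f) e.
  apply: filterS2 WQ => m [_ + _] /=; by move=> /(_ x f) e; rewrite -/(translate x f) e.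
- apply/funext => x; apply/cvg_lim => //.
  apply: (@cvg_trans _ (ev (Q p) x @[m --> U])); last exact: cvg_cst.
  apply: near_eq_cvg; near=> m.
  by have [_ _ ->] : posop (W m) Q by near: m.
Unshelve. all: by end_near. Qed.

(* A polynomial coercive on R^n: it makes the operators [W m] uniformly tight. *)
Definition nrm2 : mpoly n R := \sum_(i < n) mpolyX R (mnm1 i) ^+ 2.

Lemma ev_nrm2 y : ev nrm2 y = \sum_(i < n) y 0 i ^+ 2.
Proof.
rewrite /ev /nrm2 raddf_sum; apply: eq_bigr => i _ /=.
by rewrite rmorphXn /= mevalXU.
Qed.

Lemma ev_nrm2_ge0 y : 0 <= ev nrm2 y.
Proof. by rewrite ev_nrm2 sumr_ge0// => i _; rewrite sqr_ge0. Qed.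

Lemma ev_nrm2_ge y i : y 0 i ^+ 2 <= ev nrm2 y.
Proof.
by rewrite ev_nrm2 (bigD1 i)//= lerDl sumr_ge0// => j _; rewrite sqr_ge0.
Qed.

(** With both constants fixed, this class is stable under the operators with Q 1 = 1, and pointwise
    convergence inside it is uniform on compact sets. *)
Definition blip (B K : R) f := (forall x, `|f x| <= B) /\
  forall x y, `|f x - f y| <= K * `|x - y|.

Lemma blip_dom B K f : blip B K f -> dom f.
Proof. by move=> [fB _]; exact: dom_bounded fB. Qed.

(** [S] contracts the sup norm because it fixes constants; applied to the difference of two
    translates of [f], this preserves the Lipschitz constant. *)
Lemma posop_blip S B K f : Q 1 = 1 -> scalable Q ->
  posop S Q -> blip B K f -> blip B K (S f).
Proof.
move=> Q1 QZ SQ [fB fK].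
have SB g C : (forall x, `|g x| <= C) -> forall x, `|S g x| <= C.
  move=> gC x; have := @posop_norm _ _ S Q g (C *: 1) x SQ.
  rewrite QZ Q1 /ev !mevalZ !meval1 mulr1; apply => y.
  by rewrite /ev mevalZ meval1 mulr1.
split => [x|x y]; first exact: SB.
have [hp ht _] := SQ.
have Sx z : S f z = S (translate z f) 0 by rewrite ht /translate add0r.
have df := dom_bounded fB.
rewrite !Sx -(positive_linearB (hp 0)).
  apply: SB => z; apply: le_trans (fK _ _) _.
  by rewrite opprD addrACA subrr add0r.
all: exact: dom_translate.
Qed.

Lemma cube_compact r : compact [set y : 'rV[R]_n | forall i, `[- r, r]%classic (y ord0 i)].
Proof. apply: (@rV_compact R n (fun=> `[- r, r]%classic)) => i; exact: segment_compact. Qed.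

Lemma cvg_near_compact (C : set 'rV[R]_n) B K (g_ : nat -> 'rV[R]_n -> R) g e :
  compact C -> 0 < e -> blip B K g -> (\forall m \near U, blip B K (g_ m)) ->
  (forall x, g_ m x @[m --> U] --> g x) ->
  \forall m \near U, forall x, C x -> `|g_ m x - g x| <= e.
Proof.
move=> /compact_near_coveringP cC e0 gBK g_BK g_g.
apply: (cC _ U (fun m x => `|g_ m x - g x| <= e)) => x _.
(* On a ball of radius e / (3 |K| + 1) a K-Lipschitz function is within e / 3 of its value at the
   centre; the absolute value keeps the denominator positive for any [K]. *)
have K0 : 0 < 3 * `|K| + 1 by rewrite ltr_wpDl// mulr_ge0.
have e3 : 0 < e / 3 by rewrite divr_gt0.
have lip h y : blip B K h -> ball x (e / (3 * `|K| + 1)) y -> `|h y - h x| <= e / 3.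
  move=> [_ hK]; rewrite -ball_normE/= distrC => xy.
  apply: le_trans (hK _ _) _; rewrite -[_ - _]opprB normrN in xy *.
  apply: (@le_trans _ _ (`|K| * (e / (3 * `|K| + 1)))).
    by apply: le_trans (ler_wpM2r _ (ler_norm K)) _ => //; rewrite ler_wpM2l// ltW.
  by rewrite mulrA ler_pdivrMr//; lra.
exists (ball x (e / (3 * `|K| + 1)), [set m | blip B K (g_ m) /\ `|g_ m x - g x| <= e / 3]).
  split => /=; first by apply: nbhsx_ballx; rewrite divr_gt0.
  near=> m; split; first by near: m.
  by near: m; move/cvgrPdistC_le : (g_g x); apply.
move=> [y m] [/= xy [g_m gm]].
have h1 := lip _ _ g_m xy; have h2 := lip _ _ gBK xy.
have -> : g_ m y - g y = (g_ m y - g_ m x) + (g_ m x - g x) - (g y - g x) by ring.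
rewrite (le_trans (ler_normB _ _))// (le_trans (lerD (ler_normD _ _) (lexx _)))//.
lra.
Unshelve. all: by end_near. Qed.

(** Operator and argument vary together. The difference g_m - g is small on a large cube by uniform
    convergence there, and outside it is bounded by a small multiple of |y|^2; as the [W m] act
    alike on |y|^2, the error is uniform in m. *)
Lemma cvg_ulim_comp B K (g_ : nat -> 'rV[R]_n -> R) g x :
  Q 1 = 1 -> linear Q ->
  blip B K g -> (\forall m \near U, blip B K (g_ m)) ->
  (forall x, g_ m x @[m --> U] --> g x) ->
  W m (g_ m) x @[m --> U] --> ulim g x.
Proof.
move=> Q1 Qlin gBK g_BK g_g.
have QZ := GRing.scalable_linear Qlin.
pose a := ev (Q nrm2) x; pose r := Num.max 0 B * 2.
have hc : W m g x @[m --> U] --> ulim g x by apply: cvg_ulim; exact: blip_dom gBK.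
apply/cvgrPdist_le => e e0.
(* The cube has half side s with s^2 = r2, chosen so that (r / r2) |a| <= e / 3, where r bounds |g_m
   - g| everywhere. *)
pose r2 := (r * `|a| + 1) * 3 / e.
have r0 : 0 <= r by rewrite mulr_ge0// le_max lexx.
have r20 : 0 < r2.
  by rewrite divr_gt0// mulr_gt0// ltr_wpDl// mulr_ge0.
pose s := Num.sqrt r2.
have e3 : 0 < e / 3 by rewrite divr_gt0.
near=> m.
have WmQ : posop (W m) Q by near: m.
have [hp _ hQ] := WmQ.
have gmBK : blip B K (g_ m) by near: m.
have close y : (forall i, `[- s, s]%classic (y ord0 i)) -> `|g_ m y - g y| <= e / 3.
  by move: y; near: m; exact: (cvg_near_compact (@cube_compact s) e3 gBK g_BK g_g).
have bnd y : `|g_ m y - g y| <= ev ((e / 3) *: 1 + (r / r2) *: nrm2) y.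
  rewrite evD !evZ /ev meval1 -/(ev _ _) mulr1.
  have [inC|] := pselect (forall i, `[- s, s]%classic (y ord0 i)).
    apply: le_trans (close _ inC) _; rewrite lerDl.
    by rewrite mulr_ge0 ?ev_nrm2_ge0// divr_ge0// ltW.
  move=> /existsNP[i /negP]; rewrite /= in_itv/= -ler_norml -ltNge => yi.
  have yr2 : r2 <= ev nrm2 y.
    apply: le_trans (ev_nrm2_ge y i); rewrite -[y 0 i ^+ 2]real_normK ?num_real//.
    by rewrite -[r2]sqr_sqrtr ?(ltW r20)// ler_sqr ?nnegrE ?sqrtr_ge0// ltW.
  apply: le_trans (ler_normB _ _) _; apply: (@le_trans _ _ r).
    rewrite /r mulr_natr mulr2n; have maxB : B <= Num.max 0 B by rewrite le_max lexx orbT.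
    by rewrite lerD// (le_trans _ maxB)//; [exact: gmBK.1|exact: gBK.1].
  rewrite -[leLHS]add0r lerD ?(ltW e3)// mulrAC ler_pdivlMr// ler_wpM2l//.
have Wbnd : `|W m (g_ m) x - W m g x| <= 2 * (e / 3).
  rewrite -(positive_linearB (hp x)); [rewrite /=|exact: blip_dom gmBK|exact: blip_dom gBK].
  have hb := @posop_norm _ _ _ _ (fun y => g_ m y - g y) _ x WmQ bnd.
  apply: (le_trans hb).
  rewrite Qlin QZ Q1 evD !evZ /ev meval1 -/(ev _ _) mulr1 -/a.
  have -> : 2 * (e / 3) = e / 3 + e / 3 by ring.
  rewrite lerD2l /r2 (le_trans (ler_wpM2l _ (ler_norm a)))//.
    by rewrite divr_ge0// ltW.
  rewrite invf_div mulrA mulrAC ler_pdivrMr; last first.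
    by rewrite mulr_gt0// ltr_wpDl// mulr_ge0.
  nra.
have hm : `|ulim g x - W m g x| <= e / 3.
  by near: m; move/cvgrPdist_le : hc; exact.
have -> : ulim g x - W m (g_ m) x = (ulim g x - W m g x) - (W m (g_ m) x - W m g x).
  by ring.
rewrite (le_trans (ler_normB _ _))// (le_trans (lerD hm Wbnd))//.
lra.
Unshelve. all: by end_near. Qed.

(** Induction on j: the inner iterates form the varying argument of [cvg_ulim_comp]. *)
Lemma cvg_iter_ulim B K f j x :
  Q 1 = 1 -> linear Q ->
  blip B K f -> iter j (W m) f x @[m --> U] --> iter j ulim f x.
Proof.
move=> Q1 Qlin fBK; have QZ := GRing.scalable_linear Qlin.
have blip_iter S i : posop S Q -> blip B K (iter i S f).
  by move=> SQ; elim: i => //= i; exact: posop_blip.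
elim: j x => [|j IH] x /=; first exact: cvg_cst.
apply: cvg_ulim_comp IH => //; first exact/blip_iter/posop_ulim.
by apply: filterS WQ => m; exact: blip_iter.
Qed.

End Ultralimit.

Lemma divisible_functionals (n : nat) (R : realType) (A : fps n R) :
  frakd_plus A -> exists S : nat -> ('rV[R]_n -> R) -> 'rV[R]_n -> R,
    (forall k, (0 < k)%N ->
      posop (S k) (fps_act (fps_exp (fps_scale k%:R^-1 A)))) /\
    (forall k B K f x, (0 < k)%N -> blip B K f -> iter k (S k) f x = S 1%N f x).
Proof.
move=> [A0 Apos]; pose E t := fps_act (fps_exp (fps_scale t A)).
have E1 t : E t 1 = 1 by exact: fps_act_exp1.
have Elin t : linear (E t) by move=> c p p'; exact: linearP.
have /boolp.choice[T TE] (m : nat) : exists S, posop S (E (m`!%:R^-1)).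
  apply: posop_exists.
  by have [] := Apos (m`!%:R^-1) _ => //; rewrite invr_ge0.
(* One ultrafilter serves all k, which makes the roots coherent. *)
have [U [UU Uoo]] := @ultraFilterLemma nat eventually _.
(* For m >= k > 0, k divides m!, so this power of [T m] acts as exp (A / k) on polynomials and its
   k-th power is [W 1 m]. Smaller m are invisible to [U]. *)
pose W k m := iter (m`! %/ k) (T m).
have kfact k m : (0 < k)%N -> (k <= m)%N -> (m`! %/ k * k = m`!)%N.
  by move=> k0 km; apply/divnK/dvdn_fact; rewrite k0.
have WE k : (0 < k)%N -> \forall m \near U, posop (W k m) (E (k%:R^-1)).
  move=> k0; apply: Uoo; exists k => // m /= km.
  apply: eq_posop (posop_iter _ (TE m)) => p.
  rewrite /E (iter_fps_act_exp _ _ _ A0).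
  suff -> : (m`! %/ k)%:R * m`!%:R^-1 = k%:R^-1 :> R by [].
  have f0 : (m`!%:R : R) != 0 by rewrite pnatr_eq0 -lt0n fact_gt0.
  have k0' : (k%:R : R) != 0 by rewrite pnatr_eq0 -lt0n.
  apply: (mulfI f0); rewrite mulrCA divff// mulr1 -{2}(kfact _ _ k0 km).
  by rewrite natrM mulfK.
exists (fun k => ulim U (W k)); split => [k k0|k B K f x k0 fBK].
  exact/posop_ulim/WE.
have := cvg_iter_ulim UU (WE k k0) (j := k) (x := x) (E1 _) (Elin _) fBK.
move=> /cvg_lim <- //; congr (lim _).
have e : \forall m \near U, iter k (W k m) f x = W 1%N m f x.
  apply: Uoo; exists k => // m /= km.
  by rewrite /W divn1 -{2}(kfact _ _ k0 km) mulnC iterM.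
by apply/seteqP; split => B'; apply: filterS2 e => m /= ->.
Qed.

(** * Borel measures on R^n and their convolutions *)

Section BorelRV.
Variables (n : nat) (R : realType).
Local Notation T := (borel_rV n R).

Lemma open_measurable_rV (V : set 'rV[R]_n) : open V -> measurable (V : set T).
Proof. exact: sub_gen_smallest. Qed.

Lemma continuous_measurable_rV (f : 'rV[R]_n -> R) : continuous f ->
  measurable_fun [set: T] (f : T -> R).
Proof.
move=> cf; apply: (measurability _ (measurable_realfun.RGenOInfty.measurableE R)).
move=> _ [_ [a ->] <-]; rewrite setTI; apply: open_measurable_rV.
by apply: open_comp => [x _|]; [exact: cf|exact: interval_open].
Qed.

(** The sigma-algebra is generated by open sets rather than by coordinates. An open set is a
    countable union of boxes with rational centres and radii 1 / (k + 1), whose preimages involve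
    finitely many coordinates. *)
Lemma measurable_fun_rV d (S : measurableType d) (f : S -> T) :
  (forall i, measurable_fun [set: S] (fun s => (f s : 'rV[R]_n) 0 i)) ->
  measurable_fun [set: S] f.
Proof.
move=> mf.
pose B (c : 'rV[rat]_n * nat) : set 'rV[R]_n := [set x : 'rV[R]_n |
  forall i, `|ratr (c.1 0 i) - x 0 i| < c.2.+1%:R^-1].
apply: (measurability _ (erefl (@measurable _ T))).
move=> _ [V oV <-]; rewrite setTI.
(* Boxes not inside [V] are replaced by the empty set, so that the union runs over a countable
   type. *)
have -> : f @^-1` V = \bigcup_c (if `[< B c `<=` V >] then f @^-1` B c else set0).
  apply/seteqP; split => [s Vs|s [c _]]; last first.
    by case: asboolP => // BV Bs; exact: BV.
  have [e /= e0 eV] : nbhs_ball (f s : 'rV[R]_n) V.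
    by apply/nbhs_ballP; rewrite nbhsE; exists V.
  (* Coordinates of two points of a box of radius 1 / (k + 1) differ by less than 2 / (k + 1) <=
     e. *)
  pose k := Num.truncn (2 / e).
  have ke : 2 * k.+1%:R^-1 <= e.
    rewrite ler_pdivrMr// mulrC -ler_pdivrMr//.
    by rewrite ltW// /k truncnS_gt.
  have k0 : (0 : R) < k.+1%:R^-1 by rewrite invr_gt0.
  have /choice[c cP] i : exists q : rat, `|ratr q - (f s : 'rV[R]_n) 0 i| < k.+1%:R^-1.
    have [|q] := @rat_in_itvoo R ((f s : 'rV[R]_n) 0 i - k.+1%:R^-1)
      ((f s : 'rV[R]_n) 0 i + k.+1%:R^-1).
      by rewrite ltrD2l (lt_trans _ k0)// oppr_lt0.
    by rewrite in_itv/= => qP; exists q; rewrite ltr_distl.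
  exists (\row_i c i, k) => //.
  case: asboolP => [_|]; first by move=> i /=; rewrite mxE; exact: cP.
  case=> x Bx; apply: eV; rewrite /= -[ball]/(@mx_ball _ _ _ _); split => // i j.
  rewrite (ord1 i) -ball_normE /=; have := Bx j; have := cP j; rewrite /= mxE => h1 h2.
  apply: lt_le_trans ke.
  have -> : (f s : 'rV[R]_n) 0 j - x 0 j =
      (ratr (c j) - x 0 j) - (ratr (c j) - (f s : 'rV[R]_n) 0 j) by ring.
  by apply: le_lt_trans (ler_normB _ _) _; rewrite mulr_natl mulr2n ltrD.
apply: countable_bigcupT_measurable => [|c]; first exact: countableP.
case: asboolP => // _.
have -> : f @^-1` B c = \bigcap_(i in [set: 'I_n])
    [set s | `|ratr (c.1 0 i) - (f s : 'rV[R]_n) 0 i| < c.2.+1%:R^-1].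
  by apply/seteqP; split => [s h i _|s h i]; [exact: h|exact: h].
apply: fin_bigcap_measurable => // i _.
rewrite -[X in measurable X]setTI.
have mg : measurable_fun [set: S] (fun s => `|ratr (c.1 0 i) - (f s : 'rV[R]_n) 0 i| : R).
  by apply: measurableT_comp => //; apply: measurable_funB.
have := mg measurableT `]-oo, c.2.+1%:R^-1[%classic (measurable_itv _).
by congr measurable; apply/seteqP; split => s /=; rewrite in_itv/=.
Qed.

Lemma measurable_coord i : measurable_fun [set: T] (fun x : T => (x : 'rV[R]_n) 0 i).
Proof. by apply: continuous_measurable_rV; exact: coord_continuous. Qed.

Lemma measurable_addrV : measurable_fun [set: T * T]
  (fun z : T * T => ((z.1 : 'rV[R]_n) + (z.2 : 'rV[R]_n))%R : T).
Proof.
apply: measurable_fun_rV => i.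
rewrite (_ : (fun _ => _) = (fun z : T * T => (z.1 : 'rV[R]_n) 0 i + (z.2 : 'rV[R]_n) 0 i)).
  apply: measurable_funD.
    by apply: (measurableT_comp (measurable_coord i)); exact: measurable_fst.
  by apply: (measurableT_comp (measurable_coord i)); exact: measurable_snd.
by apply/funext => z; rewrite mxE.
Qed.

Lemma measurable_translate (y : 'rV[R]_n) : measurable_fun [set: T]
  (fun x : T => ((x : 'rV[R]_n) + y)%R : T).
Proof.
apply: measurable_fun_rV => i.
rewrite (_ : (fun _ => _) = (fun x : T => (x : 'rV[R]_n) 0 i + y 0 i)).
  by apply: measurable_funD => //; exact: measurable_coord.
by apply/funext => z; rewrite mxE.
Qed.

End BorelRV.

Section AsProbability.
Variables (d : measure_display) (T : measurableType d) (R : realType).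
Variables (nu : {measure set T -> \bar R}) (nuT : nu setT = 1%E).

(** An alias carrying the proof of total mass 1, so that the probability structure can be inferred
    from the term. *)
Definition as_probability (_ : nu setT = 1%E) : set T -> \bar R := nu.

HB.instance Definition _ := Measure.on (as_probability nuT).

HB.instance Definition _ :=
  Measure_isProbability.Build _ _ _ (as_probability nuT) nuT.

Lemma measure_probability : exists P : probability T R, (P : set T -> \bar R) = nu.
Proof. by exists (as_probability nuT). Qed.

End AsProbability.

Lemma pushforward_measure d d' (S : measurableType d) (T : measurableType d')
    (R : realType) (m : {measure set S -> \bar R}) (f : S -> T) :
  measurable_fun setT f ->
  exists P : {measure set T -> \bar R}, (P : set T -> \bar R) = pushforward m f.
Proof.
move=> mf.
by unshelve eexists (pushforward m f : {measure set T -> \bar R}).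
Qed.

(** * Convolution of probability measures *)

Section Convolution.
Variables (n : nat) (R : realType).
Local Notation T := (borel_rV n R).
Local Open Scope ereal_scope.

(** The measure is the image of the product measure under addition. Tonelli's theorem gives the
    integral formula, whose case of indicators identifies the set function [convolution]. *)
Lemma convolution_measure (mu nu : probability T R) : exists rho : probability T R,
  (forall E, measurable E -> convolution mu nu E = rho E) /\
  (forall f : T -> \bar R, measurable_fun setT f -> (forall x, 0 <= f x) ->
    \int[rho]_x f x =
    \int[nu]_y \int[mu]_x f (((x : 'rV[R]_n) + (y : 'rV[R]_n))%R : T)).
Proof.
have [P PE] := pushforward_measure (mu \x nu) (@measurable_addrV n R).
have Pint (f : T -> \bar R) : measurable_fun setT f -> (forall x, 0 <= f x) ->
    \int[P]_x f x =
    \int[nu]_y \int[mu]_x f (((x : 'rV[R]_n) + (y : 'rV[R]_n))%R : T).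
  move=> mf f0; rewrite PE ge0_integral_pushforward//; last exact: measurable_addrV.
  rewrite preimage_setT fubini_tonelli2//.
    exact: (measurableT_comp mf (@measurable_addrV n R)).
  by move=> z /=; exact: f0.
have intE E : measurable E -> P E = convolution mu nu E.
  move=> mE; have := Pint (fun x => (\1_E x)%:E) _ _.
  rewrite integral_indic// setIT => -> //; first last.
    by apply/measurable_EFinP; exact: measurable_indic.
  apply: eq_integral => y _.
  have mEy := @measurable_translate n R y measurableT E mE.
  rewrite setTI in mEy.
  transitivity (\int[mu]_x (\1_[set x : T | E (((x : 'rV[R]_n) + (y : 'rV[R]_n))%R : T)] x)%:E).
    by apply: eq_integral => x _; rewrite !indicE.
  by rewrite integral_indic// setIT.
have P1 : P setT = 1.
  rewrite intE// /convolution; transitivity (\int[nu]_(y in setT) cst 1 y).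
    by apply: eq_integral => y _; exact: probability_setT.
  by rewrite integral_cst// mul1e; exact: probability_setT.
have [rho rhoE] := measure_probability P1.
exists rho; rewrite rhoE; split => // E mE; by rewrite -intE.
Qed.

Lemma convolution_pow_measure (nu : probability T R) :
  exists rho : nat -> probability T R,
  [/\ (rho 0%N : set T -> \bar R) = dirac ((0%R : 'rV[R]_n) : T),
   forall k E, measurable E -> convolution_pow nu k E = rho k E &
   forall k (f : T -> \bar R), measurable_fun setT f -> (forall x, 0 <= f x) ->
    \int[rho k.+1]_x f x =
    \int[nu]_y \int[rho k]_x f (((x : 'rV[R]_n) + (y : 'rV[R]_n))%R : T)].
Proof.
have /boolp.choice[c cP] mu := convolution_measure mu nu.
exists (fun k => iter k c (dirac ((0%R : 'rV[R]_n) : T))); split => // [k E mE|k f mf f0].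
  elim: k E mE => [//|k IH] E mE /=.
  rewrite -(cP _).1//; apply: eq_integral => y _; apply: IH.
  have := @measurable_translate n R y measurableT E mE.
  by rewrite setTI.
exact: (cP _).2.
Qed.

(** Total masses multiply under convolution, and 1 is the only m in [0, +oo] with m^k = 1. *)
Lemma convolution_pow_setT (nu : {measure set T -> \bar R}) k : (0 < k)%N ->
  convolution_pow nu k setT = 1 -> nu setT = 1.
Proof.
have S j : convolution_pow nu j.+1 setT = convolution_pow nu j setT * nu setT.
  by rewrite /convolution_pow iterS -/(convolution_pow nu j) /convolution -integral_cst.
case: k => // k _; have : 0 <= nu setT := measure_ge0 nu setT.
case E : (nu setT) => [r| |] => [|_|//].
  rewrite lee_fin => r0.
  have -> : convolution_pow nu k.+1 setT = (r ^+ k.+1)%:E.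
    elim: k => [|k IH]; first by rewrite S /convolution_pow/= diracT E mul1e.
    by rewrite S IH E -EFinM -exprSr.
  case=> rk; congr (_%:E); apply/eqP; rewrite -(@pexpr_eq1 _ _ k.+1)//.
  exact/eqP.
have -> : convolution_pow nu k.+1 setT = +oo; last by [].
elim: k => [|k IH]; first by rewrite S /convolution_pow/= diracT E mul1e.
by rewrite S IH E mulyy.
Qed.

Lemma blip_continuous B K (f : 'rV[R]_n -> R) : blip B K f -> continuous f.
Proof.
move=> [_ fK] x; apply/(@cvgrPdist_le _ _ _ (nbhs x) (nbhs_filter x)) => e e0.
have K0 : (0 < `|K| + 1)%R by rewrite ltr_wpDl.
near=> y; apply: (le_trans (fK _ _)).
apply: (@le_trans _ _ ((`|K| + 1) * (e / (`|K| + 1)))%R); last first.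
  by rewrite mulrCA divff ?mulr1// gt_eqF.
apply: (@le_trans _ _ ((`|K| + 1) * `|x - y|)%R).
  by rewrite ler_wpM2r// (le_trans (ler_norm K))// lerDl.
rewrite ler_wpM2l ?(ltW K0)//; near: y.
by apply: (@cvgr_dist_le _ _ _ (nbhs x) (nbhs_filter x) id x) => //; rewrite divr_gt0.
Unshelve. all: by end_near. Qed.

Lemma blip_measurable B K (f : 'rV[R]_n -> R) : blip B K f ->
  measurable_fun [set: T] (f : T -> R).
Proof. by move=> /blip_continuous; exact: continuous_measurable_rV. Qed.

(** Open sets form a generating class stable under intersection. The indicator of an open set is the
    increasing limit in j of min (1, j d), with d the distance to the complement, and these
    functions are bounded and j-Lipschitz. *)
Lemma probability_blip_unique (P Q : probability T R) :
  (forall B K f, blip B K f -> (forall x, 0 <= f x)%R ->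
    \int[P]_x (f x)%:E = \int[Q]_x (f x)%:E) ->
  forall E, measurable E -> P E = Q E.
Proof.
move=> PQ; apply: (@measure_unique _ R T (@open 'rV[R]_n) (fun=> setT)) => //.
- exact: openI.
- by move=> _; exact: openT.
- by rewrite bigcup_const.
- move=> V oV; have mV := open_measurable_rV oV.
  (* The distance to the complement needs a point outside [V]; the whole space is treated apart. *)
  have [V0|/set0P[z0 nVz0]] := eqVneq (~` V) set0.
    have VT : V = setT by rewrite -[LHS]setCK V0 setC0.
    by rewrite VT; transitivity (1 : \bar R); [exact: probability_setT|exact/esym/probability_setT].
  pose D (x : 'rV[R]_n) : set R := [set `|x - (y : 'rV[R]_n)|%R | y in ~` V].
  pose dist x := inf (D x).
  have Dlb x : has_lbound (D x) by exists 0%R => _ [y _ <-].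
  have D0 x : D x !=set0 by exists `|x - (z0 : 'rV[R]_n)|%R; exists z0.
  have dist_ge0 x : (0 <= dist x)%R by apply: lb_le_inf => // _ [y _ <-].
  have dist_le x z : (dist x <= dist z + `|x - z|)%R.
    rewrite -lerBlDr; apply: lb_le_inf => // _ [y nVy <-].
    rewrite lerBlDr; apply: (@le_trans _ _ `|x - y|%R).
      by apply: ge_inf => //; exists y.
    by rewrite [leRHS]addrC -(subrKA z x (- (y : 'rV[R]_n))%R); exact: ler_normD.
  have distN x : ~ V x -> dist x = 0%R.
    move=> nVx; apply/eqP; rewrite eq_le dist_ge0 andbT.
    by apply: ge_inf => //; exists x => //; rewrite subrr normr0.
  have dist_gt0 x : V x -> (0 < dist x)%R.
    move=> Vx; have [e /= e0 eV] : nbhs_ball x V.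
      by apply/nbhs_ballP; rewrite nbhsE; exists V.
    apply: (lt_le_trans e0); apply: lb_le_inf => // _ [y nVy <-].
    rewrite leNgt; apply/negP => xy; apply: nVy; apply: eV.
    by rewrite -ball_normE.
  pose f (j : nat) x := Num.min 1%R (j%:R * dist x)%R.
  have f0 j x : (0 <= f j x)%R by rewrite le_min ler01 mulr_ge0.
  have fblip j : blip 1 j%:R (f j).
    split => [x|x y]; first by rewrite ger0_norm// ge_min lexx.
    have key a b : (f j a - f j b <= j%:R * `|a - b|)%R.
      have := ler_wpM2l (ler0n R j) (dist_le a b); rewrite mulrDr => h.
      have h0 : (0 <= j%:R * `|a - b|)%R by rewrite mulr_ge0.
      rewrite /f /Num.min; do 2 case: ifPn; rewrite -?leNgt; lra.
    by rewrite ler_norml lerNl opprB key distrC key.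
  have intV (M : probability T R) :
      M V = limn (fun j => \int[M]_x (f j x)%:E).
    have -> : M V = \int[M]_x (\1_V x)%:E by rewrite integral_indic// setIT.
    rewrite -monotone_convergence//.
    + apply: eq_integral => x _; apply/esym/cvg_lim => //.
      apply: cvg_near_cst; rewrite indicE.
      have [xV|xV] := boolP (x \in V); last first.
        have /negP nVx : x \notin V by [].
        apply: nearW => j; rewrite /f distN ?mulr0 ?minElt//.
          by rewrite ltr10.
        by move=> Vx; apply: nVx; rewrite inE.
      have dx : (0 < dist x)%R by apply: dist_gt0; rewrite inE in xV.
      exists (Num.truncn (dist x)^-1).+1 => // j /= hj; congr (_%:E).
      apply/min_idPl; rewrite -ler_pdivrMr// div1r ltW//.
      by apply: lt_le_trans (truncnS_gt _) _; rewrite ler_nat.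
    + by move=> j; apply/measurable_EFinP; exact: blip_measurable (fblip j).
    + by move=> j x _; rewrite lee_fin.
    + move=> x _ i j ij; rewrite lee_fin /f le_min ge_min lexx/=.
      by rewrite ge_min ler_wpM2r ?ler_nat// orbT.
  transitivity (limn (fun j => \int[P]_x (f j x)%:E)); first exact: intV.
  transitivity (limn (fun j => \int[Q]_x (f j x)%:E)); last exact/esym/intV.
  by congr (limn _); apply/funext => j; exact: PQ (fblip j) _.
- by move=> k; apply: (@le_lt_trans _ _ 1); [exact: probability_le1|exact: ltry].
Qed.

End Convolution.

(** * From positive functionals to measures *)

Section Tree.
Variables (n : nat) (R : realType).
Local Notation V := 'rV[R]_n.
Variable J : (V -> R) -> R.
Hypotheses (HJ : positive_linear J) (J1 : J (fun=> 1) = 1).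
Variable B : nat -> set V.
Implicit Types (f g : V -> R) (S E : set V).

(** A finitely additive probability on all subsets; countable additivity will come from Lebesgue
    measure on [0, 1). *)
Definition mass (S : set V) : R := J (fun x => \1_S x).

Lemma dom_indic (S : set V) : @dom n R (fun x => \1_S x).
Proof.
by apply: (@dom_bounded _ _ 1) => x; rewrite ger0_norm ?ler0n// indicE lern1 leq_b1.
Qed.

Lemma mass_ge0 S : 0 <= mass S.
Proof. by apply: HJ.2; [exact: dom_indic|move=> x; rewrite indicE ler0n]. Qed.

Lemma massT : mass setT = 1.
Proof. by rewrite -J1; congr J; apply/funext => x; rewrite indicT. Qed.

Lemma mass0 : mass set0 = 0.
Proof. by rewrite -(positive_linear0 HJ); congr J; apply/funext => x; rewrite indic0. Qed.

Lemma dom_mul_indic f S : dom f -> dom (fun x => f x * \1_S x).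
Proof.
move=> df; apply: dom_le (dom_norm df) _ => x; rewrite normrM ler_piMr//.
by rewrite ger0_norm ?ler0n// indicE lern1 leq_b1.
Qed.

Lemma indic_split S E x : \1_(S `&` E) x + \1_(S `\` E) x = \1_S x :> R.
Proof.
rewrite !indicE in_setI in_setD; case: (x \in S); case: (x \in E) => /=;
  by rewrite ?(addr0, add0r).
Qed.

Lemma J_split f S E : dom f -> J (fun x => f x * \1_S x) =
  J (fun x => f x * \1_(S `&` E) x) + J (fun x => f x * \1_(S `\` E) x).
Proof.
move=> df; rewrite -(positive_linearD HJ); try exact: dom_mul_indic.
by congr J; apply/funext => x; rewrite -mulrDr indic_split.
Qed.

Lemma mass_split S E : mass S = mass (S `&` E) + mass (S `\` E).
Proof.
rewrite /mass -(positive_linearD HJ); try exact: dom_indic.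
by congr J; apply/funext => x; rewrite indic_split.
Qed.

(* A cell is a set of the partition generated by [B 0, ..., B (j-1)], together
   with the left end of the subinterval of [0, 1), of length its mass, that
   codes it. *)
Definition lcell (j : nat) (c : set V * R) := (c.1 `&` B j, c.2).
Definition rcell (j : nat) (c : set V * R) :=
  (c.1 `\` B j, c.2 + mass (c.1 `&` B j)).

Fixpoint cells (j : nat) : seq (set V * R) :=
  if j is j'.+1 then flatten [seq [:: lcell j' c; rcell j' c] | c <- cells j']
  else [:: (setT, 0)].

(** Descends the binary tree of partitions: for [w] in [0, 1), this is the cell of level j whose
    interval contains [w]. *)
Fixpoint cell_path (j : nat) (w : R) : set V * R :=
  if j is j'.+1 then
    let c := cell_path j' w in
    if w < c.2 + mass (c.1 `&` B j') then lcell j' c else rcell j' c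
  else (setT, 0).

Definition cell_itv (c : set V * R) : set R := `[c.2, c.2 + mass c.1[%classic.

Lemma big_cells (F : set V * R -> R) j : \sum_(c <- cells j.+1) F c =
  \sum_(c <- cells j) (F (lcell j c) + F (rcell j c)).
Proof.
rewrite /= big_flatten/= big_map; apply: eq_bigr => c _.
by rewrite !big_cons big_nil addr0.
Qed.

Lemma cell_path_itv j w : 0 <= w < 1 -> cell_itv (cell_path j w) w.
Proof.
move=> w01; elim: j => [|j]; first by rewrite /cell_itv /= in_itv/= add0r massT.
rewrite /cell_itv /= !in_itv/= => /andP[h1 h2].
case: ifPn => [wl|]; first by rewrite h1 /= wl.
by rewrite -leNgt => h /=; rewrite h -addrA -mass_split.
Qed.

(** The intervals of one level partition [0, 1), so a single term survives. In the induction, [phi']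
    gives each cell the value of the child selected by [w]. *)
Lemma sum_cells (phi : set V * R -> R) j w : 0 <= w < 1 ->
  \sum_(c <- cells j) phi c * \1_(cell_itv c) w = phi (cell_path j w).
Proof.
move=> w01; elim: j phi => [|j IH] phi.
  rewrite /= big_cons big_nil addr0 indicE mem_set ?mulr1//.
  exact: (cell_path_itv 0 w01).
pose phi' c := if w < c.2 + mass (c.1 `&` B j) then phi (lcell j c) else phi (rcell j c).
transitivity (phi' (cell_path j w)); last by rewrite /phi' /=; case: ifP.
rewrite -IH big_cells; apply: eq_bigr => c _; rewrite /phi' !indicE !mem_setE /cell_itv /=.
rewrite -addrA -mass_split.
have := mass_ge0 (c.1 `&` B j); have := mass_ge0 (c.1 `\` B j).
have := mass_split c.1 (B j) => e h1 h2; rewrite !in_itv/=.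
have [wl|wl] := ltP w (c.2 + mass (c.1 `&` B j)).
  have -> : w < c.2 + mass c.1 by rewrite (lt_le_trans wl)// lerD2l e lerDl.
  by rewrite mulr0 addr0 andbT.
by rewrite andbF mulr0 add0r /= (le_trans _ wl) ?lerDl.
Qed.

Lemma cells_itv j c : c \in cells j -> 0 <= c.2 /\ c.2 + mass c.1 <= 1.
Proof.
elim: j c => [|j IH] c /=; first by rewrite inE => /eqP -> /=; rewrite add0r massT.
move=> /flatten_mapP[d /IH[d0 d1]]; have := mass_split d.1 (B j) => e.
have h1 := mass_ge0 (d.1 `&` B j); have h2 := mass_ge0 (d.1 `\` B j).
rewrite !inE => /orP[|] /eqP -> /=; split => //; lra.
Qed.

Lemma sum_cells_J f j : dom f -> \sum_(c <- cells j) J (fun x => f x * \1_(c.1) x) = J f.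
Proof.
move=> df; elim: j => [|j IH].
  rewrite /= big_cons big_nil addr0; congr J; apply/funext => x.
  by rewrite indicT mulr1.
rewrite big_cells -IH; apply: eq_bigr => c _ /=; by rewrite -J_split.
Qed.

Lemma sum_cells_mass j : \sum_(c <- cells j) mass c.1 = 1.
Proof.
elim: j => [|j IH]; first by rewrite /= big_cons big_nil addr0 massT.
by rewrite big_cells -IH; apply: eq_bigr => c _; rewrite -mass_split.
Qed.

Lemma cell_path_sub j k w : (j <= k)%N -> (cell_path k w).1 `<=` (cell_path j w).1.
Proof.
elim: k => [|k IH]; first by rewrite leqn0 => /eqP ->.
rewrite leq_eqVlt => /predU1P[->//|/IH h]; apply: subset_trans h => x /=.
by case: ifP => _ [].
Qed.

Lemma cell_path_decided j k w : (j < k)%N ->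
  (cell_path k w).1 `<=` B j \/ (cell_path k w).1 `<=` ~` B j.
Proof.
move=> /cell_path_sub h; have := h w; rewrite /=; case: ifP => _ s; [left|right].
  by move=> x /s[].
by move=> x /s[].
Qed.

Lemma cells_decided j k c : (j < k)%N -> c \in cells k ->
  c.1 `<=` B j \/ c.1 `<=` ~` B j.
Proof.
elim: k c => // k IH c; rewrite ltnS leq_eqVlt => /predU1P[->|jk];
  rewrite /= => /flatten_mapP[d dk]; rewrite !inE => /orP[|] /eqP -> /=.
- by left => x [].
- by right => x [].
- by have [h|h] := IH _ jk dk; [left|right] => x [/h].
- by have [h|h] := IH _ jk dk; [left|right] => x [/h].
Qed.

(** The default 0 concerns empty cells only, whose intervals are empty as well. *)
Definition cell_point (c : set V * R) : V := xget 0 c.1.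

Lemma cell_point_in (c : set V * R) : 0 < mass c.1 -> c.1 (cell_point c).
Proof.
rewrite /cell_point => mc; case: xgetP => // nc; exfalso.
have c0 : c.1 = set0 by apply/seteqP; split => // x cx; exact: (nc x).
by move: mc; rewrite c0 mass0 ltxx.
Qed.

Lemma cell_point_path j w : 0 <= w < 1 -> (cell_path j w).1 (cell_point (cell_path j w)).
Proof.
move=> /(cell_path_itv j); rewrite /cell_itv /= in_itv/= => /andP[h1 h2].
by apply: cell_point_in; rewrite -(ltrD2l (cell_path j w).2) addr0 (le_lt_trans h1).
Qed.

(** A sum of multiples of indicators, convenient for measurability and integration; on [0, 1) it is
    the value of [g] at the chosen point of the cell coded by [w]. *)
Definition step (g : V -> R) j (w : R) : R :=
  \sum_(c <- cells j) g (cell_point c) * \1_(cell_itv c) w.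

Lemma stepE g j w : 0 <= w < 1 -> step g j w = g (cell_point (cell_path j w)).
Proof. exact: sum_cells. Qed.

Lemma measurable_step g j : measurable_fun setT (step g j).
Proof.
apply: measurable_sum => c; apply: measurable_funM => //.
by apply: measurable_indic; exact: measurable_itv.
Qed.

Let I01 : set R := `[0, 1[%classic.
Let mI01 : measurable I01. Proof. exact: measurable_itv. Qed.

Definition lebesgue01 := mrestr (@lebesgue_measure R) mI01.

HB.instance Definition _ := Measure.on lebesgue01.

Lemma lebesgue01_cell j c : c \in cells j -> lebesgue01 (cell_itv c) = (mass c.1)%:E.
Proof.
move=> /cells_itv[c0 c1]; rewrite /lebesgue01 /mrestr.
rewrite (_ : cell_itv c `&` I01 = cell_itv c).
  rewrite lebesgue_measure_itv/= lte_fin; case: ltP => [_|].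
    by rewrite -EFinB addrAC subrr add0r.
  by rewrite gerDl => h; congr (_%:E); apply/eqP; rewrite eq_le h mass_ge0.
apply/setIidPl => w; rewrite /cell_itv /I01 /= !in_itv/= => /andP[h1 h2].
by rewrite (le_trans c0 h1) (lt_le_trans h2 c1).
Qed.

Lemma integral_step g j : (forall x, 0 <= g x) ->
  (\int[lebesgue01]_w (step g j w)%:E =
   (\sum_(c <- cells j) g (cell_point c) * mass c.1)%:E)%E.
Proof.
move=> g0; rewrite -sumEFin.
under eq_integral do rewrite /step -sumEFin.
rewrite ge0_integral_sum//.
- rewrite big_seq [RHS]big_seq; apply: eq_bigr => c cj.
  under eq_integral do rewrite EFinM.
  rewrite ge0_integralZl//.
  + rewrite integral_indic//; last exact: measurable_itv.
    rewrite setIT [RHS]EFinM; congr (_ * _)%E; exact: lebesgue01_cell cj.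
  + by apply/measurable_EFinP; apply: measurable_indic; exact: measurable_itv.
  + by rewrite lee_fin.
- move=> c; apply/measurable_EFinP/measurable_funM => //.
  by apply: measurable_indic; exact: measurable_itv.
- by move=> c w _; rewrite lee_fin mulr_ge0.
Qed.

(** The difference is the sum over the cells c of J ((g (cell_point c) - g) 1_c), each term being at
    most e times the mass of c. *)
Lemma cells_approx g j (e : R) : dom g ->
  (forall c x y, c \in cells j -> c.1 x -> c.1 y -> `|g x - g y| <= e) ->
  `|\sum_(c <- cells j) g (cell_point c) * mass c.1 - J g| <= e.
Proof.
move=> dg osc; rewrite -(sum_cells_J j dg) -sumrB.
apply: le_trans (ler_norm_sum _ _ _) _.
rewrite -[leRHS]mulr1 -(sum_cells_mass j) mulr_sumr big_seq [leRHS]big_seq.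
apply: ler_sum => c cj; rewrite /mass -!(positive_linearZ HJ); try exact: dom_indic.
rewrite -(positive_linearB HJ); last 2 first.
- exact: dom_scale (dom_indic _).
- exact: dom_mul_indic.
apply: (positive_linear_norm HJ); last 1 first.
- move=> x; rewrite -mulrBl normrM [X in _ * X]ger0_norm; last by rewrite indicE ler0n.
  rewrite indicE; have [xc|_] := boolP (x \in c.1); last by rewrite !mulr0.
  rewrite inE in xc; rewrite !mulr1; apply: (osc _ _ _ cj _ xc).
  exact: (@xgetI _ 0 _ _ xc).
- apply: dom_sub; first exact: dom_scale (dom_indic _).
  exact: dom_mul_indic.
- exact: dom_scale (dom_indic _).
Qed.

End Tree.

(** * The limit of the step functions and its law *)

Section Law.
Variables (n : nat) (R : realType).
Local Notation V := 'rV[R]_n.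
Variable J : (V -> R) -> R.
Hypotheses (HJ : positive_linear J) (J1 : J (fun=> 1) = 1).
Implicit Types (f g : V -> R) (S E : set V).

(** An enumeration of the half-spaces x_i < q with q rational, used as the sets [B] that generate
    the partitions; a number coding no pair gives the empty set. *)
Definition halfspace (k : nat) : set V :=
  if @unpickle ('I_n * rat)%type k is Some iq then [set x : V | x 0 iq.1 < ratr iq.2]
  else set0.

Lemma halfspace_pickle i (q : rat) :
  halfspace (pickle (i, q)) = [set x : V | x 0 i < ratr q].
Proof. by rewrite /halfspace pickleK. Qed.

Local Notation cell j := (cells J halfspace j).
Local Notation Z j w := (cell_point (cell_path J halfspace j w)).
Local Notation lambda := (@lebesgue01 R).

(** Up to e, the value of [g] is fixed by finitely many comparisons of coordinates with rationals,
    hence by the cell at a deep enough level. *)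
Definition tame g := forall e : R, 0 < e -> exists s : seq ('I_n * rat), forall x y : V,
  (forall iq, iq \in s -> (x 0 iq.1 < ratr iq.2) = (y 0 iq.1 < ratr iq.2)) ->
  `|g x - g y| <= e.

Lemma cells_compare j c iq x y : c \in cell j -> (pickle iq < j)%N ->
  c.1 x -> c.1 y -> (x 0 iq.1 < ratr iq.2) = (y 0 iq.1 < ratr iq.2).
Proof.
case: iq => i q cj kj cx cy /=.
have [|] := cells_decided kj cj; rewrite halfspace_pickle => h.
  by rewrite (h _ cx) (h _ cy).
by rewrite (negbTE (introN idP (h _ cx))) (negbTE (introN idP (h _ cy))).
Qed.

Lemma cell_path_compare j w iq x y : (pickle iq < j)%N ->
  (cell_path J halfspace j w).1 x -> (cell_path J halfspace j w).1 y ->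
  (x 0 iq.1 < ratr iq.2) = (y 0 iq.1 < ratr iq.2).
Proof.
case: iq => i q kj cx cy /=.
have [|] := @cell_path_decided _ _ J halfspace _ _ w kj; rewrite halfspace_pickle => h.
  by rewrite (h _ cx) (h _ cy).
by rewrite (negbTE (introN idP (h _ cx))) (negbTE (introN idP (h _ cy))).
Qed.

Lemma tame_approx g (e : R) : dom g -> tame g -> 0 < e -> exists j0 : nat,
  forall j, (j0 <= j)%N -> `|\sum_(c <- cell j) g (cell_point c) * mass J c.1 - J g| <= e.
Proof.
move=> dg tg /tg[s sP]; exists (\max_(iq <- s) (pickle iq).+1)%N => j sj.
apply: (cells_approx HJ J1 dg) => c x y cj cx cy; apply: sP => iq iqs.
apply: (cells_compare cj) => //; apply: leq_trans sj.
by rewrite (big_rem _ iqs)/= leq_max ltnSn.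
Qed.

Lemma tame_cvg g : dom g -> tame g -> (forall x, 0 <= g x) ->
  (\int[lambda]_w (step J halfspace g j w)%:E)%E @[j --> \oo] --> (J g)%:E.
Proof.
move=> dg tg g0; under eq_fun do rewrite integral_step//.
apply: cvg_EFin; first exact: nearW.
apply/cvgrPdist_le => e e0 /=; have [j0 j0P] := tame_approx dg tg e0.
by exists j0 => // j /= /j0P; rewrite distrC.
Qed.

(** The cells along the path of [w] are nested, and from level k + 1 on they lie on one side of the
    half-space of code k. *)
Lemma comparison_stabilizes i (q : rat) w : 0 <= w < 1 ->
  (\forall j \near \oo, (Z j w) 0 i < ratr q) \/
  (\forall j \near \oo, ratr q <= (Z j w) 0 i).
Proof.
move=> w01; set k := pickle (i, q).
have [h|h] := @cell_path_decided _ _ J halfspace k k.+1 w (ltnSn _); [left|right];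
  exists k.+1 => // j /= kj; have := cell_point_path HJ J1 halfspace j w01;
  move=> /(cell_path_sub kj)/h; rewrite halfspace_pickle//=.
by move=> /negP; rewrite -leNgt.
Qed.

Definition tight w := forall i, exists b, \forall j \near \oo, `|(Z j w) 0 i| <= b.

(** A Dedekind cut: the limit is the supremum of the rationals that are eventually lower bounds, and
    each rational above it is eventually an upper bound because comparisons stabilize. *)
Lemma tight_cvg w i : 0 <= w < 1 -> tight w -> cvg ((Z j w) 0 i @[j --> \oo]).
Proof.
move=> w01 /(_ i)[b bP]; pose u j := (Z j w) 0 i.
pose S : set R := [set r | exists2 q : rat, r = ratr q & \forall j \near \oo, ratr q <= u j].
have Sub : ubound S (b + 1).
  move=> _ [q -> qu]; near \oo => j.
  apply: (@le_trans _ _ (u j)); first by near: j.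
  by apply: (@le_trans _ _ b); [apply: le_trans (ler_norm _) _; near: j|rewrite lerDl].
have S0 : S !=set0.
  have [|q] := @rat_in_itvoo R (- b - 1) (- b); first by rewrite ltrBlDr ltrDl.
  rewrite in_itv/= => /andP[_ qb]; exists (ratr q), q => //.
  near=> j; rewrite (le_trans (ltW qb))// lerNl (le_trans (ler_norm _))//.
  by rewrite normrN; near: j.
pose l := sup S.
apply/cvg_ex; exists l; apply/cvgrPdist_lt => e e0.
have [_ [q -> qu] lq] : exists2 r, S r & l - e < r.
  by apply: sup_adherent => //; split => //; exists (b + 1).
have [|p] := @rat_in_itvoo R l (l + e); first by rewrite ltrDl.
rewrite in_itv/= => /andP[lp ple].
have [pu|pu] := comparison_stabilizes i p w01; last first.
  have : ratr p <= l by apply: ub_le_sup; [exists (b + 1)|exists p].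
  by rewrite leNgt lp.
near=> j; rewrite distrC ltr_distl; apply/andP; split.
  by apply: (lt_le_trans lq); near: j.
by apply: lt_trans ple; near: j.
Unshelve. all: by end_near. Qed.

(** Upper limits are measurable in [w] without any convergence, and equal the limits at tight [w] in
    [0, 1); [fine] sends infinite values to 0. *)
Definition limit_point (w : R) : V :=
  \row_i fine (limn_esup (fun j => (step J halfspace (fun x => x 0 i) j w)%:E)).

Lemma measurable_limit_point :
  measurable_fun setT (limit_point : R -> borel_rV n R).
Proof.
apply: measurable_fun_rV => i; under eq_fun do rewrite mxE.
apply: (measurableT_comp (@measurable_realfun.fine_measurable R setT measurableT)).
apply: measurable_fun_limn_esup => j.
by apply/measurable_EFinP; exact: measurable_step.
Qed.

Lemma limit_pointP w : 0 <= w < 1 -> tight w -> Z j w @[j --> \oo] --> limit_point w.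
Proof.
move=> w01 tw; have lim i : (Z j w) 0 i @[j --> \oo] --> limit_point w 0 i.
  have /cvg_ex[l ul] := @tight_cvg w i w01 tw.
  rewrite mxE (_ : (fun j => _) = (fun j => ((Z j w) 0 i)%:E)); last first.
    by apply/funext => j; rewrite stepE.
  have ul' : ((Z j w) 0 i)%:E @[j --> \oo] --> l%:E by apply: cvg_EFin ul; exact: nearW.
  by rewrite (cvg_limn_einf_sup ul').2.
apply/cvg_ballP => e e0.
have : \forall j \near \oo, forall i, ball (limit_point w 0 i) e ((Z j w) 0 i).
  by apply: filter_forall => i; move: e e0; apply/cvg_ballP; exact: lim.
apply: filterS => j h; split => // a i; rewrite (ord1 a); exact: h.
Qed.

(** The cube is half-open so that membership is decided by the comparisons x_i < -M and x_i < M. *)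
Definition outside (M : nat) : set V :=
  [set x | ~~ [forall i : 'I_n, (- M%:R <= x 0 i) && (x 0 i < M%:R)]].

Definition thresholds (M : nat) : seq ('I_n * rat) :=
  [seq (i, - M%:R) | i <- enum 'I_n] ++ [seq (i, M%:R) | i <- enum 'I_n].

Lemma mem_thresholds M i : (i, - M%:R) \in thresholds M /\ (i, M%:R) \in thresholds M.
Proof.
by split; rewrite mem_cat; apply/orP; [left|right]; apply/mapP; exists i;
  rewrite ?mem_enum.
Qed.

Lemma outside_compare M (x y : V) : (forall iq, iq \in thresholds M ->
    (x 0 iq.1 < ratr iq.2) = (y 0 iq.1 < ratr iq.2)) ->
  \1_(outside M) x = \1_(outside M) y :> R.
Proof.
move=> xy; rewrite !indicE !mem_setE; congr ((~~ _ : nat)%:R).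
apply: eq_forallb => i; have [h1 h2] := mem_thresholds M i.
have := xy _ h1; have := xy _ h2; rewrite /= !rmorphN /= !ratr_nat => -> e.
by rewrite !leNgt e.
Qed.

Lemma outside_tame M : tame (fun x => \1_(outside M) x).
Proof.
move=> e e0; exists (thresholds M) => x y /outside_compare ->.
by rewrite subrr normr0 ltW.
Qed.

Let C : R := J (ev (nrm2 n R)).

(** Chebyshev's inequality: outside the cube, |x|^2 >= M^2 >= M. *)
Lemma J_outside M : (0 < M)%N -> J (fun x => \1_(outside M) x) <= C / M%:R.
Proof.
move=> M0; have M0' : 0 < M%:R :> R by rewrite ltr0n.
rewrite mulrC -(positive_linearZ HJ); last exact: dom_ev.
apply: (positive_linear_le HJ); [exact: dom_indic|exact/dom_scale/dom_ev|].
move=> x; rewrite indicE; case: (boolP (x \in outside M)) => [|_]; last first.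
  by rewrite mulr_ge0 ?invr_ge0// ev_nrm2_ge0.
rewrite inE /outside /= negb_forall => /existsP[i].
rewrite negb_and -leNgt -ltNge => hi.
have xi : M%:R <= `|x 0 i|.
  rewrite ler_normr; case/orP: hi => h; apply/orP; [right|left]; last exact: h.
  by rewrite lerNr; exact: ltW.
rewrite ler_pdivlMl// mulr1; apply: le_trans (ev_nrm2_ge x i).
rewrite -[x 0 i ^+ 2]real_normK ?num_real//.
apply: (@le_trans _ _ (M%:R ^+ 2)); last by rewrite ler_sqr// nnegrE.
by rewrite expr2 ler_peMl ?ler1n// ltW.
Qed.

Lemma measurable_step_ge g j (a : R) :
  measurable [set w | a <= step J halfspace g j w].
Proof.
rewrite (_ : [set w | _] = [set: R] `&` step J halfspace g j @^-1` `[a, +oo[%classic).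
  by apply: measurable_step; [exact: measurableT|exact: measurable_itv].
by rewrite setTI; apply/seteqP; split => w /=; rewrite in_itv/= andbT.
Qed.

(** Markov's inequality for the step function of the indicator, at a level deep enough for its
    integral to be within 1 / M of its [J] value and for all thresholds to be decided. *)
Lemma lebesgue01_outside M : (0 < M)%N -> exists j,
  (lambda [set w | (1 <= step J halfspace (fun x => \1_(outside M) x) j w)%R]
    <= ((C + 1) / M%:R)%:E)%E /\
  forall iq, iq \in thresholds M -> (pickle iq < j)%N.
Proof.
move=> M0; have M0' : 0 < M%:R^-1 :> R by rewrite invr_gt0 ltr0n.
pose g : V -> R := fun x => \1_(outside M) x.
have g0 x : 0 <= g x by rewrite /g indicE ler0n.
have [j0 j0P] := @tame_approx g _ (dom_indic _) (outside_tame M) M0'.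
pose j := maxn j0 (\max_(iq <- thresholds M) (pickle iq).+1)%N.
exists j; split; last first.
  by move=> iq iqM; rewrite leq_max (big_rem _ iqM)/= leq_max ltnSn orbT.
have mA := measurable_step_ge g j 1.
have step0 w : 0 <= step J halfspace g j w.
  by apply: sumr_ge0 => c _; rewrite mulr_ge0// indicE ler0n.
apply: (@le_trans _ _ (\int[lambda]_w (step J halfspace g j w)%:E)%E); last first.
  rewrite integral_step// lee_fin mulrDl mul1r.
  have := j0P j (leq_maxl _ _); have := J_outside M0; rewrite -/g.
  rewrite ler_norml => h1 /andP[_ h2]; lra.
rewrite (_ : lambda _ = \int[lambda]_w (\1_[set w | (1 <= step J halfspace g j w)%R] w)%:E)%E.
  apply: ge0_le_integral => //.
  - by apply/measurable_EFinP; exact: measurable_indic.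
  - by apply/measurable_EFinP; exact: measurable_step.
  - move=> w _; rewrite lee_fin indicE; case: (boolP (w \in _)) => //.
    by rewrite inE.
by rewrite integral_indic// setIT.
Qed.

(** A path inside the cube at level [jj M], where the thresholds are decided, stays inside. Hence
    the points of [0, 1) that are not tight lie in every [A M], and the measures of these sets are
    bounded by (C + 1) / (M + 1). *)
Lemma ae_tight : {ae lambda, forall w, 0 <= w < 1 /\ tight w}.
Proof.
have /boolp.choice[jj jjP] M := @lebesgue01_outside M.+1 (ltn0Sn M).
pose A M : set R := [set w | 1 <= step J halfspace (fun x => \1_(outside M.+1) x) (jj M) w].
have mA M : measurable (A M) by exact: measurable_step_ge.
exists (~` `[0%R, 1%R[%classic `|` \bigcap_M A M); split.
- by apply: measurableU; [by apply: measurableC; exact: measurable_itv|exact: bigcapT_measurable].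
- apply/eqP; rewrite eq_le measure_ge0 andbT.
  apply: le_trans (measureU2 _ _ _) _.
  + by apply: measurableC; exact: measurable_itv.
  + exact: bigcapT_measurable.
  rewrite [X in (X + _)%E](_ : _ = 0%E) ?add0e; last first.
    transitivity (@lebesgue_measure R (~` `[0%R, 1%R[%classic `&` `[0%R, 1%R[%classic)).
      by [].
    by rewrite setICl measure0.
  apply/lee_addgt0Pr => e e0; rewrite add0e.
  have [M hM] : exists M : nat, (C + 1) / M.+1%:R <= e.
    exists (Num.truncn ((C + 1) / e)); rewrite ler_pdivrMr// mulrC -ler_pdivrMr//.
    by rewrite ltW// truncnS_gt.
  apply: (@le_trans _ _ (lambda (A M))).
    by apply: le_measure => [| |w]; rewrite ?inE; [exact: bigcapT_measurable|exact: mA|exact].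
  by apply: le_trans (jjP M).1 _; rewrite lee_fin.
- move=> w /= nw; apply: contrapT => /not_orP[w01 wA]; apply: nw.
  have {}w01 : 0 <= w < 1.
    by apply: contrapT => h; apply: w01; rewrite /= in_itv/=.
  split => // i; move/existsNP : wA => [M /not_implyP[_ wA]].
  exists M.+1%:R; exists (jj M) => // j /= jMj.
  have Zj := cell_point_path HJ J1 halfspace j w01.
  have ZM := cell_point_path HJ J1 halfspace (jj M) w01.
  have e : \1_(outside M.+1) (Z j w) = \1_(outside M.+1) (Z (jj M) w) :> R.
    apply: outside_compare => iq iqM.
    by apply: (cell_path_compare ((jjP M).2 _ iqM) _ ZM); exact: cell_path_sub jMj _ Zj.
  move: wA; rewrite /A /= stepE// -e indicE => wA.
  have /negP : ~ outside M.+1 (Z j w) by move=> h; apply: wA; rewrite mem_set.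
  rewrite negbK => /forallP/(_ i)/andP[h1 h2].
  by rewrite ler_norml h1 ltW.
Qed.

Lemma lebesgue01_setT : lambda setT = 1%E.
Proof.
transitivity (@lebesgue_measure R (setT `&` `[0%R, 1%R[%classic)); first by [].
by rewrite setTI lebesgue_measure_itv/= lte_fin ltr01 oppr0 adde0.
Qed.

(** The integrals of the step functions of [g] converge to [J g] by tameness, and to the integral of
    [g] along [limit_point] by dominated convergence. *)
Lemma law_tame (P : {measure set (borel_rV n R) -> \bar R}) g b :
  (P : set _ -> \bar R) = pushforward lambda (limit_point : R -> borel_rV n R) ->
  continuous g -> tame g -> (forall x, 0 <= g x <= b) ->
  (\int[P]_x (g x)%:E = (J g)%:E)%E.
Proof.
move=> PE cg tg gb; have dg : dom g.
  by apply: (@dom_bounded _ _ b) => x; have /andP[g0 gb'] := gb x; rewrite ger0_norm.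
have g0 x : 0 <= g x by have /andP[] := gb x.
have mg : measurable_fun [set: borel_rV n R] (fun x => (g x)%:E).
  by apply/measurable_EFinP; exact: continuous_measurable_rV.
rewrite PE ge0_integral_pushforward//; [|exact: measurable_limit_point|].
  rewrite preimage_setT.
  have := @dominated_convergence _ _ _ lambda setT measurableT
    (fun j w => (step J halfspace g j w)%:E) (fun w => (g (limit_point w))%:E)
    (fun=> b%:E).
  case.
  - by move=> j; apply/measurable_EFinP; exact: measurable_step.
  - exact: (measurableT_comp mg measurable_limit_point).
  - apply: (@filterS _ _ (ae_filter_ringOfSetsType lambda) _ _ _ ae_tight) => w [w01 tw] _.
    apply: cvg_EFin; first exact: nearW.
    under eq_fun do rewrite stepE//.
    by apply: continuous_cvg; [exact: cg|exact: limit_pointP].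
  - apply/integrableP; split; first exact: measurable_cst.
    rewrite (_ : (fun _ => _) = cst `|b|%:E%E)// integral_cst//.
    rewrite (_ : (_ * _)%E = `|b|%:E) ?ltry// -[RHS]mule1; congr (_ * _)%E.
    exact: lebesgue01_setT.
  - apply: (@filterS _ _ (ae_filter_ringOfSetsType lambda) _ _ _ ae_tight) => w [w01 _] j _.
    rewrite stepE// lee_fin ger0_norm//.
    by have /andP[] := gb (Z j w).
  move=> _ _ h; have := tame_cvg dg tg g0.
  by move=> h'; apply: cvg_unique h h'.
by move=> x _; rewrite lee_fin.
Qed.

End Law.

(** * Truncation to cubes *)

Section Clip.
Variables (n : nat) (R : realType).
Local Notation V := 'rV[R]_n.
Implicit Types (f g : V -> R) (p : mpoly n R) (x y : V).

Definition clip (r : R) (x : V) : V := \row_i Num.max (- r) (Num.min r (x 0 i)).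

Lemma clip_lipschitz (r a b : R) :
  `|Num.max (- r) (Num.min r a) - Num.max (- r) (Num.min r b)| <= `|a - b|.
Proof.
have key c d : c <= d -> `|Num.max (- r) (Num.min r c) - Num.max (- r) (Num.min r d)| <= d - c.
  move=> cd; rewrite ler_norml /Num.max /Num.min.
  by repeat case: ifPn; rewrite -?leNgt => *; apply/andP; split; lra.
have [ab|/ltW ba] := leP a b.
  by rewrite (le_trans (key _ _ ab))// -opprB ler0_norm// subr_le0.
by rewrite distrC (le_trans (key _ _ ba))// ger0_norm// subr_ge0.
Qed.

Lemma clip_ball r x y (e : R) : ball x e y -> ball (clip r x) e (clip r y).
Proof.
move=> [e0 xy]; split => // i j; rewrite (ord1 i); have := xy 0 j.
rewrite -!ball_normE /= !mxE; apply: le_lt_trans; exact: clip_lipschitz.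
Qed.

Lemma clip_continuous r : continuous (clip r).
Proof.
move=> x; apply/(@cvg_ballP _ _ _ _ (nbhs_filter x)) => e e0.
by near=> y; apply: clip_ball; near: y; exact: nbhsx_ballx.
Unshelve. all: by end_near. Qed.

Lemma clip_itv r x i : 0 <= r -> - r <= clip r x 0 i <= r.
Proof.
by move=> r0; rewrite mxE le_max lexx ge_max ge_min lexx/= andbT ge0_cp.
Qed.

Lemma clip_id r x : (forall i, `|x 0 i| <= r) -> clip r x = x.
Proof.
move=> h; apply/rowP => i; rewrite mxE; have := h i; rewrite ler_norml => /andP[h1 h2].
by rewrite (min_idPr h2) (max_idPr h1).
Qed.

Lemma clip_near x : \forall M \near \oo, clip M%:R x = x.
Proof.
have : \forall M \near \oo, forall i : 'I_n, `|x 0 i| <= M%:R.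
  apply: filter_forall => i; exists (Num.truncn `|x 0 i|).+1 => // M /= hM.
  by apply: ltW; apply: lt_le_trans (truncnS_gt _) _; rewrite ler_nat.
by apply: filterS => M; exact: clip_id.
Qed.

Lemma ler_sqr_clip (a r s : R) : 0 <= r -> r <= s ->
  Num.max (- r) (Num.min r a) ^+ 2 <= Num.max (- s) (Num.min s a) ^+ 2.
Proof.
move=> r0 rs; rewrite /Num.max /Num.min.
by repeat case: ifPn; rewrite -?leNgt => *; nra.
Qed.

Lemma ler_sqr_clip_id (a r : R) : 0 <= r ->
  Num.max (- r) (Num.min r a) ^+ 2 <= a ^+ 2.
Proof.
move=> r0; rewrite /Num.max /Num.min.
by repeat case: ifPn; rewrite -?leNgt => *; nra.
Qed.

(** [f] is uniformly continuous on the cube, and comparisons with a rational grid of mesh below its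
    modulus d locate clipped coordinates to within d. *)
Lemma tame_clip f (M : nat) : continuous f -> tame (f \o clip M%:R).
Proof.
move=> cf e e0.
pose K := [set x : V | forall i, `[- M%:R, M%:R]%classic (x ord0 i)].
have Kclip x : K (clip M%:R x).
  by move=> i; rewrite /= in_itv/=; exact: clip_itv.
have [d d0 dP] : exists2 d : R, 0 < d & forall x y, K x -> ball x d y -> `|f x - f y| <= e.
  have : \forall d \near 0^'+, K `<=` [set x | forall y, ball x d y -> `|f x - f y| <= e].
    have /compact_near_coveringP cK := @cube_compact n R M%:R.
    apply: (cK R (0 : R)^'+ (fun d x => forall y, ball x d y -> `|f x - f y| <= e)) => x _.
    have e2 : 0 < e / 2 by rewrite divr_gt0.
    have : nbhs x [set y | `|f x - f y| <= e / 2].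
      by move: (cf x) => /(@cvgrPdist_le _ _ _ _ (nbhs_filter x))/(_ _ e2).
    move=> /nbhs_ballP[d /= d0 dP]; have d2 : 0 < d / 2 by rewrite divr_gt0.
    exists (ball x (d / 2), [set c | c < d / 2]).
      by split => /=; [exact: nbhsx_ballx|exact: nbhs_right_lt].
    move=> [z c] [/= xz cd] y zy.
    have h1 : `|f x - f z| <= e / 2.
      by apply: dP; apply: le_ball xz; rewrite ler_pdivrMr// ler_pMr// ler1n.
    have h2 : `|f x - f y| <= e / 2.
      apply: dP; rewrite [X in ball _ X _](splitr d); apply: ball_triangle xz _.
      by apply: le_ball zy; exact: ltW.
    rewrite -[f z - f y](subrKA (f x)) (le_trans (ler_normD _ _))//.
    by rewrite [e]splitr lerD// distrC.
  move=> H; have [d [d0 dK]] : exists d : R, 0 < d /\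
      K `<=` [set x | forall y, ball x d y -> `|f x - f y| <= e].
    near (0 : R)^'+ => d; exists d; split; first by near: d; exact: nbhs_right_gt.
    by near: d.
  by exists d => // x y Kx xy; exact: dK.
pose N := Num.truncn d^-1.
have Nd : N.+1%:R^-1 < d.
  by rewrite invf_plt ?posrE ?ltr0n// /N truncnS_gt.
pose q (l : nat) : rat := - M%:R + l%:R / N.+1%:R.
have qE l : ratr (q l) = - M%:R + l%:R / N.+1%:R :> R.
  by rewrite /q rmorphD rmorphN /= fmorph_div/= !ratr_nat.
exists [seq (i, q l) | i <- enum 'I_n, l <- iota 0 (2 * M * N.+1).+1] => x y xy /=.
apply: dP => //; split => // a i; rewrite (ord1 a) -ball_normE /= !mxE.
have le (u v : V) : (forall iq,
     iq \in [seq (i, q l) | i <- enum 'I_n, l <- iota 0 (2 * M * N.+1).+1] ->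
     (u 0 iq.1 < ratr iq.2) = (v 0 iq.1 < ratr iq.2)) ->
   Num.max (- M%:R) (Num.min M%:R (v 0 i)) < Num.max (- M%:R) (Num.min M%:R (u 0 i)) + d.
  move=> uv; set cu := Num.max _ (Num.min _ (u 0 i)); set cv := Num.max _ _.
  rewrite ltNge; apply/negP => duv.
  have := @clip_itv M%:R u i (ler0n _ _); rewrite mxE -/cu => /andP[cu1 cu2].
  have := @clip_itv M%:R v i (ler0n _ _); rewrite mxE -/cv => /andP[cv1 cv2].
  have N0 : (0 : R) < N.+1%:R by rewrite ltr0n.
  (* [q l] is the first grid point strictly above [cu]. If [cv] were at least cu + d, this point
     would not exceed [cv], and comparison with it would separate u from v. *)
  pose l := (Num.truncn ((cu + M%:R) * N.+1%:R)).+1.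
  have l1 : (cu + M%:R) * N.+1%:R < l%:R by exact: truncnS_gt.
  have l2 : l%:R <= (cu + M%:R) * N.+1%:R + 1.
    rewrite /l -natr1 lerD2r truncn_le// mulr_ge0//.
    by rewrite -lerBlDr sub0r.
  have ql1 : cu < ratr (q l).
    by rewrite qE addrC -ltrBlDr opprK ltr_pdivlMr.
  have ql2 : ratr (q l) <= cv.
    apply: le_trans duv; rewrite qE addrC -lerBrDr opprK ler_pdivrMr//.
    apply: (le_trans l2); rewrite !mulrDl [leRHS]addrAC lerD2l.
    by rewrite -ler_pdivrMr// div1r ltW.
  have ql0 : - M%:R < ratr (q l) :> R by rewrite (le_lt_trans cu1).
  have lM : (l < (2 * M * N.+1).+1)%N.
    rewrite ltnS -(ler_nat R) !natrM; have := le_trans ql2 cv2.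
    rewrite qE addrC -lerBrDr opprK ler_pdivrMr// => h; apply: (le_trans h).
    by rewrite ler_wpM2r ?ler0n//; lra.
  have mem : (i, q l) \in [seq (i, q l) | i <- enum 'I_n, l <- iota 0 (2 * M * N.+1).+1].
    by apply/allpairsPdep; exists i, l; rewrite mem_enum mem_iota.
  have := uv _ mem; rewrite /=.
  have -> : u 0 i < ratr (q l).
    have : Num.min M%:R (u 0 i) < ratr (q l).
      by apply: le_lt_trans ql1; rewrite /cu le_max lexx orbT.
    by rewrite gt_min => /orP[h|//]; move: (lt_le_trans h (le_trans ql2 cv2)); rewrite ltxx.
  have -> : v 0 i < ratr (q l) = false.
    apply/negbTE; rewrite -leNgt; move: ql2; rewrite /cv le_max leNgt ql0/=.
    by rewrite le_min => /andP[].
  by [].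
rewrite ltr_distl ltrBlDr; apply/andP; split; first exact: le.
by apply: le => iq h; rewrite xy.
Unshelve. all: by end_near. Qed.

End Clip.

(** * Probability measures for positive functionals *)

Section LawTheorem.
Variables (n : nat) (R : realType).
Local Notation V := 'rV[R]_n.
Implicit Types (f g : V -> R) (p : mpoly n R) (x y : V).

Lemma ev_continuous p : continuous (ev p).
Proof.
elim/mpoly_ring_ind: p => [c|j|p1 p2 h1 h2|p1 p2 h1 h2] x.
- by rewrite (_ : ev _ = fun=> c); [exact: cst_continuous|apply/funext => y; rewrite evC].
- rewrite (_ : ev _ = fun y => y 0 j); first exact: coord_continuous.
  by apply/funext => y; rewrite /ev mevalXU.
- rewrite (_ : ev _ = fun y => ev p1 y + ev p2 y).
    by apply: (@cvgD _ _ _ _ (nbhs_filter x)); [exact: h1|exact: h2].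
  by apply/funext => y; rewrite evD.
- rewrite (_ : ev _ = fun y => ev p1 y * ev p2 y).
    by apply: (@cvgM _ _ _ (nbhs_filter x)); [exact: h1|exact: h2].
  by apply/funext => y; rewrite /ev mevalM.
Qed.

(** For C >= 0 these majorants grow with |x|, so they do not increase under [clip]: a bound for a
    function also bounds all its truncations. *)
Definition radial (C : R) (N : nat) : mpoly n R := C *: (1 + nrm2 n R) ^+ N.

Lemma ev_radial C N x : ev (radial C N) x = C * (1 + ev (nrm2 n R) x) ^+ N.
Proof. by rewrite /radial evZ /ev rmorphXn /= rmorphD /= rmorph1. Qed.

Lemma le1_nrm2 x : 1 <= 1 + ev (nrm2 n R) x.
Proof. by rewrite lerDl ev_nrm2_ge0. Qed.

Lemma radial_bound p : exists2 C, 0 <= C &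
  exists N, forall x, `|ev p x| <= ev (radial C N) x.
Proof.
elim/mpoly_ring_ind: p => [c|j|p1 p2 [C1 C10 [N1 h1]] [C2 C20 [N2 h2]]|
    p1 p2 [C1 C10 [N1 h1]] [C2 C20 [N2 h2]]].
- by exists `|c| => //; exists 0%N => x; rewrite ev_radial expr0 mulr1 evC.
- exists 1 => //; exists 1%N => x; rewrite ev_radial expr1 mul1r /ev mevalXU -/(ev _ _).
  have := ev_nrm2_ge x j; rewrite ler_norml => h.
  by apply/andP; split; nra.
- exists (C1 + C2); first exact: addr_ge0.
  exists (N1 + N2)%N => x; rewrite ev_radial evD (le_trans (ler_normD _ _))//.
  rewrite mulrDl lerD//.
    apply: le_trans (h1 x) _; rewrite ev_radial ler_wpM2l//.
    by rewrite ler_weXn2l ?le1_nrm2// leq_addr.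
  apply: le_trans (h2 x) _; rewrite ev_radial ler_wpM2l//.
  by rewrite ler_weXn2l ?le1_nrm2// leq_addl.
- exists (C1 * C2); first exact: mulr_ge0.
  exists (N1 + N2)%N => x; have -> : ev (p1 * p2) x = ev p1 x * ev p2 x by exact: mevalM.
  rewrite normrM ev_radial exprD mulrACA -!ev_radial.
  exact: ler_pM.
Qed.

Lemma radial_ge0 C N x : 0 <= C -> 0 <= ev (radial C N) x.
Proof.
by move=> C0; rewrite ev_radial mulr_ge0// exprn_ge0// (le_trans ler01)// le1_nrm2.
Qed.

Lemma radial_le C N x y : 0 <= C -> ev (nrm2 n R) x <= ev (nrm2 n R) y ->
  ev (radial C N) x <= ev (radial C N) y.
Proof.
move=> C0 xy; rewrite !ev_radial ler_wpM2l// lerXn2r ?nnegrE ?lerD2l//;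
  by rewrite (le_trans ler01)// le1_nrm2.
Qed.

Lemma nrm2_clip_le r x : 0 <= r -> ev (nrm2 n R) (clip r x) <= ev (nrm2 n R) x.
Proof.
by move=> r0; rewrite !ev_nrm2 ler_sum// => i _; rewrite mxE ler_sqr_clip_id.
Qed.

Lemma nrm2_clip_homo r s x : 0 <= r -> r <= s ->
  ev (nrm2 n R) (clip r x) <= ev (nrm2 n R) (clip s x).
Proof.
by move=> r0 rs; rewrite !ev_nrm2 ler_sum// => i _; rewrite !mxE ler_sqr_clip.
Qed.

Lemma nrm2_clip_bound r x : 0 <= r -> ev (nrm2 n R) (clip r x) <= r ^+ 2 *+ n.
Proof.
move=> r0; rewrite ev_nrm2 -[X in _ *+ X](card_ord n) -sumr_const ler_sum// => i _.
have := clip_itv x i r0; rewrite -ler_norml => h.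
by rewrite -[leLHS]real_normK ?num_real// ler_sqr ?nnegrE.
Qed.

Lemma radial_clip_bound C N r x : 0 <= C -> 0 <= r ->
  ev (radial C N) (clip r x) <= C * (1 + r ^+ 2 *+ n) ^+ N.
Proof.
move=> C0 r0; rewrite ev_radial ler_wpM2l// lerXn2r ?nnegrE ?lerD2l ?nrm2_clip_bound//.
  by rewrite (le_trans ler01)// le1_nrm2.
by rewrite addr_ge0// mulrn_wge0// exprn_ge0.
Qed.

(** The two values differ only if some |x_i| > M, and then |x|^2 >= M^2. *)
Lemma clip_error f C N (M : nat) x : 0 <= C -> (0 < M)%N ->
  (forall x, `|f x| <= ev (radial C N) x) ->
  `|f x - f (clip M%:R x)| <=
    2 / M%:R ^+ 2 * (ev (radial C N) x * ev (nrm2 n R) x).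
Proof.
move=> C0 M0 fh; have M0' : 0 < M%:R :> R by rewrite ltr0n.
have h0 := radial_ge0 N x C0; have n0 := ev_nrm2_ge0 x.
have [h|] := pselect (forall i, `|x 0 i| <= M%:R).
  by rewrite clip_id// subrr normr0 !mulr_ge0// invr_ge0 exprn_ge0// ltW.
move=> /existsNP[i /negP]; rewrite -ltNge => xi.
have xM : M%:R ^+ 2 <= ev (nrm2 n R) x.
  apply: le_trans (ev_nrm2_ge x i); rewrite -[leRHS]real_normK ?num_real//.
  by rewrite ler_sqr ?nnegrE ?ler0n// ltW.
apply: (@le_trans _ _ (2 * ev (radial C N) x)).
  rewrite mulr_natl mulr2n (le_trans (ler_normB _ _))// lerD//.
  by apply: le_trans (fh _) _; apply: radial_le => //; apply: nrm2_clip_le; exact: ltW.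
rewrite -!mulrA ler_wpM2l// mulrCA ler_peMr// mulrC ler_pdivlMr ?exprn_gt0//.
by rewrite mul1r.
Qed.

Variable J : (V -> R) -> R.
Hypotheses (HJ : positive_linear J) (J1 : J (fun=> 1) = 1).

(** A continuity property of [J] along truncations: the error is at most [J] of a polynomial of
    higher degree, times 2 / M^2. *)
Lemma cvg_clip f : dom f -> J (f \o clip M%:R) @[M --> \oo] --> J f.
Proof.
move=> [p fp]; have [C C0 [N hN]] := radial_bound p.
have fh x : `|f x| <= ev (radial C N) x.
  by apply: le_trans (fp x) _; apply: le_trans (ler_norm _) (hN x).
pose h : V -> R := fun x => ev (radial C N) x * ev (nrm2 n R) x.
have dh : dom h.
  rewrite (_ : h = ev (radial C N * nrm2 n R)); first exact: dom_ev.
  by apply/funext => x; rewrite /h /ev mevalM.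
have df : dom f by exists p.
have dfc M : dom (f \o clip M%:R).
  apply: (@dom_le _ _ _ (ev (radial C N))); first exact: dom_ev.
  move=> x /=; apply: le_trans (fh _) _.
  by apply: radial_le => //; apply: nrm2_clip_le.
have Jh0 : 0 <= J h.
  by apply: HJ.2 => // x; rewrite mulr_ge0 ?radial_ge0 ?ev_nrm2_ge0.
apply/cvgrPdist_le => e e0.
exists (Num.truncn (2 * J h / e)).+1 => // M /= hM.
have M0 : (0 < M)%N by apply: leq_trans hM.
have M0' : 0 < M%:R :> R by rewrite ltr0n.
rewrite -(positive_linearB HJ)//.
apply: (@le_trans _ _ (2 / M%:R ^+ 2 * J h)).
  rewrite -(positive_linearZ HJ)//; apply: (positive_linear_norm HJ).
  - exact: dom_sub.
  - exact: dom_scale.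
  - by move=> x; exact: clip_error.
rewrite mulrAC ler_pdivrMr ?exprn_gt0// [leRHS]mulrC -ler_pdivrMr//.
apply: (@le_trans _ _ M%:R).
  by apply: ltW; apply: lt_le_trans (truncnS_gt _) _; rewrite ler_nat.
by rewrite expr2 ler_peMl ?ler1n// ltW.
Qed.

(** The measure is the law of [limit_point]. The formula passes from truncations to radial
    polynomials by monotone convergence, then to every continuous dominated function by dominated
    convergence with a radial majorant. *)
Lemma law_of_positive_linear : exists P : probability (borel_rV n R) R,
  forall f, continuous f -> dom f -> (forall x, 0 <= f x) ->
    (\int[P]_x (f x)%:E = (J f)%:E)%E.
Proof.
have [P PE] := pushforward_measure (@lebesgue01 R) (measurable_limit_point J).
have Pclip f (M : nat) C N : 0 <= C -> continuous f ->
    (forall x, 0 <= f x <= ev (radial C N) x) ->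
    (\int[P]_x (f (clip M%:R x))%:E = (J (f \o clip M%:R))%:E)%E.
  move=> C0 cf fh.
  apply: (@law_tame _ _ J HJ J1 P (f \o clip M%:R) (C * (1 + M%:R ^+ 2 *+ n) ^+ N)) => //.
  - by move=> x; apply: continuous_comp; [exact: clip_continuous|exact: cf].
  - exact: tame_clip.
  - move=> x; have /andP[h1 h2] := fh (clip M%:R x); rewrite /= h1 (le_trans h2)//.
    exact: radial_clip_bound.
have mclip f (M : nat) : continuous f ->
    measurable_fun [set: borel_rV n R] (fun x => (f (clip M%:R x))%:E).
  move=> cf; apply/measurable_EFinP; apply: continuous_measurable_rV => x.
  by apply: (@continuous_comp _ _ _ (clip M%:R) f); [exact: clip_continuous|exact: cf].
have cev := @ev_continuous.
have Pradial C N : 0 <= C ->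
    (\int[P]_x (ev (radial C N) x)%:E = (J (ev (radial C N)))%:E)%E.
  move=> C0; have hr x : 0 <= ev (radial C N) x <= ev (radial C N) x.
    by rewrite lexx andbT radial_ge0.
  transitivity (limn (fun M => \int[P]_x (ev (radial C N) (clip M%:R x))%:E)%E).
    rewrite -monotone_convergence//.
    - apply: eq_integral => x _; apply/esym/cvg_lim => //.
      by apply: cvg_near_cst; apply: filterS (clip_near x) => M ->.
    - by move=> M; exact: mclip.
    - by move=> M x _; rewrite lee_fin radial_ge0.
    - move=> x _ a b ab; rewrite lee_fin; apply: radial_le => //.
      by apply: nrm2_clip_homo => //; rewrite ler_nat.
  under eq_fun do rewrite (Pclip (ev (radial C N)) _ C N)//.
  apply/cvg_lim => //; apply: cvg_EFin; first exact: nearW.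
  exact: cvg_clip (dom_ev _).
have Pf f : continuous f -> dom f -> (forall x, 0 <= f x) ->
    (\int[P]_x (f x)%:E = (J f)%:E)%E.
  move=> cf df f0; have [p fp] := df; have [C C0 [N hN]] := radial_bound p.
  have fh x : 0 <= f x <= ev (radial C N) x.
    rewrite f0 (le_trans (ler_norm _))// (le_trans (fp x))//.
    exact: le_trans (ler_norm _) (hN x).
  have := @dominated_convergence _ _ _ P setT measurableT
    (fun M x => (f (clip M%:R x))%:E) (fun x => (f x)%:E)
    (fun x => (ev (radial C N) x)%:E).
  case.
  - by move=> M; exact: mclip.
  - by apply/measurable_EFinP; exact: continuous_measurable_rV.
  - apply: aeW => x _; apply: cvg_near_cst.
    by apply: filterS (clip_near x) => M ->.
  - apply/integrableP; split.
      by apply/measurable_EFinP; exact: continuous_measurable_rV.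
    under eq_integral do rewrite gee0_abs ?lee_fin ?radial_ge0//.
    by rewrite Pradial// ltry.
  - apply: aeW => x M _; rewrite lee_fin ger0_norm ?f0//.
    have /andP[_ h] := fh (clip M%:R x); rewrite (le_trans h)//.
    by apply: radial_le => //; exact: nrm2_clip_le.
  move=> _ _; set u := (X in X @ _ --> _).
  have -> : u = fun M => (J (f \o clip M%:R))%:E.
    by apply/funext => M; exact: (Pclip f M C N).
  move=> h; apply: cvg_unique h _ => //.
  by apply: cvg_EFin; [exact: nearW|exact: cvg_clip].
have P1 : P setT = 1%E.
  have d1 : @dom n R (fun=> 1) by apply: (@dom_bounded _ _ 1) => x; rewrite normr1.
  have := Pf (fun=> 1) _ d1 _; rewrite J1 => <- //; last exact: cst_continuous.
  by rewrite (_ : (fun _ => _) = cst 1%E)// integral_cst// mul1e.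
have [Q QE] := measure_probability P1.
by exists Q; rewrite QE.
Qed.

End LawTheorem.

(** * Infinitely divisible representing measures *)

Section RepresentingMeasures.
Variables (n : nat) (R : realType).
Local Notation V := 'rV[R]_n.
Local Notation T := (borel_rV n R).
Implicit Types (f g : V -> R) (p : mpoly n R) (x y : V) (q : fps n R).

Lemma ev_measurable p : measurable_fun [set: T] (fun x : T => (ev p x)%:E).
Proof.
by apply/measurable_EFinP; apply: continuous_measurable_rV; exact: ev_continuous.
Qed.

Lemma ev_at0 p : ev p (0 : V) = mcoeff mnm0 p.
Proof. by rewrite -meval_at0 /ev; apply: meval_eq => i; rewrite mxE. Qed.

Lemma ev_monomial (a : multinom n) : ev (mpolyX R a) = monomial a.
Proof. by apply/funext => y; rewrite /ev mevalX. Qed.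

Lemma ev_fps_act_shiftp q p y : ev (fps_act q (shiftp (y 0) p)) 0 = ev (fps_act q p) y.
Proof. by rewrite fps_act_shiftp ev_shiftp /translate add0r. Qed.

(** A monomial is the difference of two nonnegative polynomials, its sum with a radial majorant and
    that majorant. *)
Lemma representing_measure_nonneg q (P : {measure set T -> \bar R}) :
  (forall p, (forall x, 0 <= ev p x) ->
    (\int[P]_x (ev p x)%:E = (ev (fps_act q p) 0)%:E)%E) ->
  representing_measure q P.
Proof.
move=> Pq a; have [C C0 [N hN]] := radial_bound (mpolyX R a).
pose h := radial n C N; pose p := mpolyX R a + h.
have h0 x : 0 <= ev h x by exact: radial_ge0.
have p0 x : 0 <= ev p x.
  by rewrite evD; have := hN x; rewrite ler_norml => /andP[]; rewrite -subr_ge0 opprK addrC.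
have intg r : (forall x, 0 <= ev r x) -> P.-integrable setT (fun x : T => (ev r x)%:E).
  move=> r0; apply/integrableP; split; first exact: ev_measurable.
  under eq_integral do rewrite gee0_abs ?lee_fin//.
  by rewrite Pq// ltry.
have monE : (fun y : T => (monomial a y)%:E) =
    ((fun x : T => (ev p x)%:E) \- (fun x : T => (ev h x)%:E))%E.
  by apply/funext => y /=; rewrite -EFinB evD addrK ev_monomial.
rewrite monE; split; first by apply: integrableB => //; exact: intg.
rewrite integralB//; try exact: intg.
rewrite !Pq// -EFinB; congr (_%:E); rewrite linearD evD addrK.
by rewrite -fps_actX_at0 ev_at0 meval_at0.
Qed.

Lemma integral_ev q (P : {measure set T -> \bar R}) p : representing_measure q P ->
  P.-integrable setT (fun x : T => (ev p x)%:E) /\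
  (\int[P]_x (ev p x)%:E = (ev (fps_act q p) 0)%:E)%E.
Proof.
move=> Pq; elim/mpolyind: p => [|c m p _ _ [IH1 IH2]].
  rewrite linear0 (_ : (fun x : T => _) = cst 0%E).
    by rewrite integral_cst// mul0e /ev meval0; split => //; exact: integrable0.
  by apply/funext => x; rewrite /ev meval0.
have [m1 m2] := Pq m.
have eE : (fun x : T => (ev (c *: mpolyX R m + p) x)%:E) =
   (fun x : T => c%:E * (monomial m x)%:E + (ev p x)%:E)%E.
  by apply/funext => x; rewrite evD evZ ev_monomial.
have ic := integrableZl measurableT c m1.
rewrite eE; split; first exact: integrableD.
rewrite integralD// integralZl// m2 IH2 -EFinM -EFinD; congr (_%:E).
rewrite linearP evD evZ; congr (_ * _ + _); rewrite -fps_actX_at0.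
by apply: meval_eq => i; rewrite mxE.
Qed.

Lemma integral_ev_translate q (P : {measure set T -> \bar R}) p y :
  representing_measure q P ->
  (\int[P]_x (ev p ((x : V) + y)%R)%:E = (ev (fps_act q p) y)%:E)%E.
Proof.
move=> /integral_ev => /(_ (shiftp (y 0) p))[_].
by rewrite ev_fps_act_shiftp ev_shiftp.
Qed.

(** Integrating against the j-th power means applying the convolution operator of [nu] j times. The
    class [F] is a parameter to serve both nonnegative bounded Lipschitz functions and nonnegative
    polynomials. *)
Lemma integral_convolution_pow (nu : probability T R) (rho : nat -> probability T R)
    (F : (V -> R) -> Prop) (Op : (V -> R) -> V -> R) :
  (rho 0%N : set T -> \bar R) = dirac ((0 : V) : T) ->
  (forall k (f : T -> \bar R), measurable_fun setT f -> (forall x, 0 <= f x)%E ->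
    \int[rho k.+1]_x f x = \int[nu]_y \int[rho k]_x f (((x : V) + (y : V))%R : T))%E ->
  (forall f, F f -> continuous f /\ forall x, 0 <= f x) ->
  (forall f, F f -> F (Op f)) ->
  (forall f y, F f -> (\int[nu]_x (f ((x : V) + y)%R)%:E = (Op f y)%:E)%E) ->
  forall j f y, F f -> (\int[rho j]_x (f ((x : V) + y)%R)%:E = (iter j Op f y)%:E)%E.
Proof.
move=> rho0 rhoS F0 FO FI j f y Ff; have Fi i : F (iter i Op f).
  by elim: i => //= i; exact: FO.
have mf y' : measurable_fun [set: T] (fun x : T => (f ((x : V) + y')%R)%:E).
  apply/measurable_EFinP; apply: (measurableT_comp _ (measurable_translate y')).
  by apply: continuous_measurable_rV; exact: (F0 _ Ff).1.
elim: j y => [|j IH] y.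
  rewrite rho0 integral_dirac// diracT mul1e.
  by rewrite add0r.
rewrite rhoS//; last by move=> x; rewrite lee_fin; exact: (F0 _ Ff).2.
under eq_integral do under eq_integral do rewrite -addrA.
under eq_integral do rewrite IH.
exact: FI.
Qed.

Lemma has_infdiv_of_frakd_plus (A : fps n R) : frakd_plus A ->
  has_infdiv_representing_measure (fps_exp A).
Proof.
move=> Ap; have [A0 _] := Ap; have [S [SE Siter]] := divisible_functionals Ap.
have E1 t := fps_act_exp1 t A0.
pose J k f := S k f 0.
have Jpos k : (0 < k)%N -> positive_linear (J k).
  by move=> /SE[h _ _]; exact: h.
have J1 k : (0 < k)%N -> J k (fun=> 1) = 1.
  move=> /SE[_ _ h]; have ev1 : ev 1 = (fun=> 1) :> (V -> R).
    by apply/funext => x; rewrite /ev meval1.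
  by rewrite /J -ev1 h E1 ev1.
have nuP k : (0 < k)%N -> exists P : probability T R,
    forall f, continuous f -> dom f -> (forall x, 0 <= f x) ->
    (\int[P]_x (f x)%:E = (S k f 0)%:E)%E.
  by move=> k0; exact: law_of_positive_linear (Jpos k k0) (J1 k k0).
have [mu muP] := nuP 1%N isT.
exists mu; split.
  apply: representing_measure_nonneg => p p0.
  rewrite muP//; [|exact: ev_continuous|exact: dom_ev].
  have [_ _ ->] := SE 1%N isT.
  suff -> : fps_scale 1%:R^-1 A = A by [].
  by apply/funext => a; rewrite /fps_scale invr1 mul1r.
move=> k k0; have [nu nuE] := nuP k k0; exists nu => E mE.
have [rho [rho0 rhoE rhoS]] := convolution_pow_measure nu.
(* On nonnegative bounded Lipschitz functions the k-th power of [nu] integrates f to (S k)^k f (0) =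
   S 1 f (0). *)
rewrite rhoE//; apply: probability_blip_unique mE => B K f fBK f0.
have Sk := SE k k0; have [Sh St _] := Sk.
have blipS g : blip B K g -> blip B K (S k g).
  by apply: posop_blip Sk => //; move=> c p; rewrite linearZ.
pose F g := blip B K g /\ forall x, 0 <= g x.
have key := @integral_convolution_pow nu rho F (S k) rho0 rhoS.
have := key _ _ _ k f 0; rewrite (Siter _ _ _ _ _ k0 fBK).
under eq_integral do rewrite addr0.
move=> -> //.
- by apply: muP => //; [exact: blip_continuous fBK|exact: blip_dom fBK].
- by move=> g [gBK g0]; split => //; exact: blip_continuous gBK.
- move=> g [gBK g0]; split; first exact: blipS.
  by move=> x; apply: (Sh x).2 => //; exact: blip_dom gBK.
- move=> g y [gBK g0]; have tBK : blip B K (translate y g).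
    split => [x|x z]; first exact: gBK.1.
    by rewrite (le_trans (gBK.2 _ _))// opprD addrACA subrr addr0.
  rewrite (_ : S k g y = S k (translate y g) 0); last by rewrite St /translate add0r.
  by apply: (nuE (translate y g));
    [exact: blip_continuous tBK|exact: blip_dom tBK|move=> x; exact: g0].
Qed.

End RepresentingMeasures.

(** * From infinite divisibility to positivity *)

Section Roots.
Variables (n : nat) (R : realType).
Local Notation V := 'rV[R]_n.
Local Notation T := (borel_rV n R).
Implicit Types (p : mpoly n R) (x y : V) (q : fps n R).

(** Follows from 1 + |x|^2 <= 2 (1 + |y|^2) (1 + |x + y|^2). *)
Lemma radial_translate C N x y : 0 <= C -> ev (radial n C N) x <=
  (2 * (1 + ev (nrm2 n R) y)) ^+ N * ev (radial n C N) (x + y).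
Proof.
move=> C0; rewrite !ev_radial mulrCA ler_wpM2l// -exprMn.
have n0 z : 0 <= ev (nrm2 n R) z by exact: ev_nrm2_ge0.
rewrite lerXn2r ?nnegrE//; first by rewrite addr_ge0.
  by rewrite !mulr_ge0// addr_ge0.
have : ev (nrm2 n R) x <= 2 * ev (nrm2 n R) (x + y) + 2 * ev (nrm2 n R) y.
  rewrite !ev_nrm2 !mulr_sumr -big_split/= ler_sum// => i _; rewrite mxE.
  (* The difference of the two sides is exactly this square. *)
  by have := sqr_ge0 (x 0 i + 2 * y 0 i); nra.
have := n0 (x + y); have := n0 y; nra.
Qed.

Lemma integral_cst_probability (P : probability T R) (c : \bar R) :
  (\int[P]_(x in setT) cst c x = c)%E.
Proof.
by rewrite integral_cst// -[RHS]mule1; congr (_ * _)%E; exact: probability_setT.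
Qed.

(** By Tonelli the inner integral is finite for some y, and a translate of a radial polynomial
    controls the polynomial itself. *)
Lemma radial_integrable_root (mu nu rho : probability T R) C N :
  (forall f : T -> \bar R, measurable_fun setT f -> (forall x, 0 <= f x)%E ->
    \int[rho]_x f x = \int[nu]_y \int[mu]_x f (((x : V) + (y : V))%R : T))%E ->
  0 <= C -> (\int[rho]_x (ev (radial n C N) x)%:E < +oo)%E ->
  (\int[mu]_x (ev (radial n C N) x)%:E < +oo)%E.
Proof.
move=> conv C0; pose h := ev (radial n C N).
have h0 x : 0 <= h x by exact: radial_ge0.
rewrite conv; [|exact: ev_measurable|by move=> x; rewrite lee_fin; exact: h0].
move=> fin; have [y yfin] : exists y : V,
    (\int[mu]_x (h ((x : V) + y)%R)%:E < +oo)%E.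
  apply: contrapT => /forallNP nfin; move: fin.
  have -> : (\int[nu]_y \int[mu]_x (h ((x : V) + (y : V))%R)%:E =
      \int[nu]_(y in setT) cst +oo y)%E.
    apply: eq_integral => y _; apply/eqP; rewrite -leye_eq leNgt.
    by apply/negP => hy; exact: (nfin y).
  by rewrite integral_cst_probability ltxx.
have mh : measurable_fun [set: T] (fun x : T => (h ((x : V) + y)%R)%:E).
  exact: (measurableT_comp (ev_measurable _) (measurable_translate y)).
pose c := (2 * (1 + ev (nrm2 n R) y)) ^+ N.
have c0 : 0 <= c by rewrite exprn_ge0// mulr_ge0// addr_ge0// ev_nrm2_ge0.
apply: (@le_lt_trans _ _ (\int[mu]_x (c%:E * (h ((x : V) + y)%R)%:E))%E).
  apply: ge0_le_integral => //.
  - by move=> x _; rewrite lee_fin; exact: h0.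
  - exact: ev_measurable.
  - exact: measurable_funeM.
  - by move=> x _; rewrite -EFinM lee_fin; exact: radial_translate.
rewrite ge0_integralZl//; last by move=> x _; rewrite lee_fin.
by rewrite lte_mul_pinfty.
Qed.

Lemma frakd_plus_of_has_infdiv (A : fps n R) (t : R) : frakd A -> 0 < t ->
  has_infdiv_representing_measure (fps_exp (fps_scale t A)) -> frakd_plus A.
Proof.
move=> A0 t0 [mu [mu_rep mu_div]]; split => //.
pose E s := fps_act (fps_exp (fps_scale s A)).
have muT : mu setT = 1%E.
  have [_] := integral_ev 1 mu_rep.
  rewrite fps_act_exp1//.
  rewrite (_ : (fun x : T => (ev 1 x)%:E) = cst 1%E); last first.
    by apply/funext => x; rewrite /ev meval1.
  by rewrite integral_cst// mul1e /ev meval1.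
have Epos k : (0 < k)%N -> forall p, (forall x, 0 <= ev p x) ->
    forall x, 0 <= ev (E (t / k%:R) p) x.
  move=> k0; have [nu0 nu0E] := mu_div k k0.
  have nu0T : nu0 setT = 1%E by apply: (convolution_pow_setT k0); rewrite -nu0E.
  have [nu nuE] := measure_probability nu0T.
  have [rho [rho0 rhoE rhoS]] := convolution_pow_measure nu.
  have mu_rho f : (\int[mu]_x f x = \int[rho k]_x f x)%E.
    apply: eq_measure_integral => S mS _.
    transitivity (convolution_pow nu0 k S); [exact: nu0E|rewrite -nuE; exact: rhoE].
  (* Finiteness descends one convolution factor at a time, from [rho k], which agrees with [mu], to
     [rho 1], which integrates like [nu]. *)
  have rho_fin j C N : (j < k)%N -> 0 <= C ->
      (\int[rho (k - j)%N]_x (ev (radial n C N) x)%:E < +oo)%E.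
    move=> + C0; elim: j => [_|j IH jk].
      rewrite subn0 -mu_rho; have [/integrableP[_ +] _] := integral_ev (radial n C N) mu_rep.
      under eq_integral do rewrite gee0_abs ?lee_fin ?radial_ge0//.
      by [].
    have := IH (ltnW jk); have -> : (k - j = (k - j.+1).+1)%N by rewrite -(subSn (ltnW jk)) subSS.
    by apply: (radial_integrable_root (rhoS (k - j.+1)%N)).
  have nu_fin C N : 0 <= C -> (\int[nu]_x (ev (radial n C N) x)%:E < +oo)%E.
    move=> C0; have := @rho_fin k.-1 C N; rewrite prednK// leqnn => /(_ isT C0).
    have -> : (k - k.-1 = 1)%N by case: (k) k0 => // k' _; rewrite subSnn.
    rewrite rhoS; [|exact: ev_measurable|by move=> x; rewrite lee_fin radial_ge0].
    have e (y : V) : (\int[rho 0%N]_x (ev (radial n C N) ((x : V) + y)%R)%:E =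
        (ev (radial n C N) y)%:E)%E.
      rewrite rho0 integral_dirac// ?diracT ?mul1e ?add0r//.
      exact: (measurableT_comp (ev_measurable _) (measurable_translate y)).
    by under eq_integral do rewrite e.
  (* The operator represented by [nu], read off from its moments. *)
  pose q : fps n R := fun a =>
    (\prod_(i < n) (a i)`!)%:R^-1 * fine (\int[nu]_x (monomial a x)%:E)%E.
  have nu_rep : representing_measure q nu.
    move=> a; have intg : nu.-integrable setT (fun y : T => (monomial a y)%:E).
      have [C C0 [N hN]] := radial_bound (mpolyX R a).
      have hi : nu.-integrable setT (fun x : T => (ev (radial n C N) x)%:E).
        apply/integrableP; split; first exact: ev_measurable.
        under eq_integral do rewrite gee0_abs ?lee_fin ?radial_ge0//.
        exact: nu_fin.
      apply: le_integrable hi => //; first by rewrite -ev_monomial; exact: ev_measurable.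
      move=> x _; rewrite -ev_monomial lee_fin (le_trans (hN x))//.
      exact: ler_norm.
    split => //; rewrite /q mulrA divff ?mul1r ?fineK//.
      exact: integrable_fin_num.
    by rewrite pnatr_eq0 -lt0n prodn_gt0// => i; exact: fact_gt0.
  have q0 : q mnm0 = 1.
    rewrite /q big1 ?invr1 ?mul1r; last by move=> i _; rewrite mnm0E fact0.
    rewrite (_ : (fun x : T => (monomial mnm0 x)%:E) = cst 1%E).
      by rewrite integral_cst_probability.
    apply/funext => x; rewrite /monomial big1//= => i _.
    by rewrite mnm0E expr0.
  have Qpos p : (forall x, 0 <= ev p x) -> forall x, 0 <= ev (fps_act q p) x.
    move=> p0 x; rewrite -lee_fin -(integral_ev_translate p x nu_rep).
    by apply: integral_ge0 => y _; rewrite lee_fin.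
  pose F (f : V -> R) := exists2 p, f = ev p & forall x, 0 <= ev p x.
  pose Op (f : V -> R) (y : V) := fine (\int[nu]_x (f ((x : V) + y)%R)%:E)%E.
  have OpE p : Op (ev p) = ev (fps_act q p).
    by apply/funext => y; rewrite /Op (integral_ev_translate _ _ nu_rep).
  have iterOp j p : iter j Op (ev p) = ev (iter j (fps_act q) p).
    by elim: j => //= j ->; rewrite OpE.
  have key := @integral_convolution_pow _ _ nu rho F Op rho0 rhoS.
  have root_nonneg p : (forall x, 0 <= ev p x) ->
      ev (iter k (fps_act q) p) 0 = ev (iter k (E (t / k%:R)) p) 0.
    move=> p0; have tk : k%:R * (t / k%:R) = t.
      by rewrite mulrCA divff ?mulr1// pnatr_eq0 -lt0n.
    apply: EFin_inj; rewrite iter_fps_act_exp// tk -(integral_ev p mu_rep).2 mu_rho.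
    rewrite -iterOp -key; last by exists p.
    - by under [RHS]eq_integral do rewrite -[X in ev p X]addr0.
    - by move=> _ [p' -> p'0]; split => //; exact: ev_continuous.
    - move=> _ [p' -> p'0]; exists (fps_act q p'); first exact: OpE.
      exact: Qpos.
    - by move=> _ y [p' -> p'0]; rewrite OpE (integral_ev_translate _ _ nu_rep).
  have iter_add r j p1 p2 : iter j (fps_act r) (p1 + p2) =
      iter j (fps_act r) p1 + iter j (fps_act r) p2.
    by elim: j => //= j ->; rewrite linearD.
  (* An arbitrary polynomial is a difference of two nonnegative ones. *)
  have root0 p : ev (iter k (fps_act q) p) 0 = ev (iter k (E (t / k%:R)) p) 0.
    have [C C0 [N hN]] := radial_bound p; pose h := radial n C N.
    have h0 x : 0 <= ev h x by exact: radial_ge0.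
    have ph0 x : 0 <= ev (p + h) x.
      by rewrite evD; have := hN x; rewrite ler_norml => /andP[]; rewrite -subr_ge0 opprK addrC.
    have := root_nonneg _ ph0; rewrite !iter_add !evD (root_nonneg h h0).
    exact: addIr.
  have iter_mderivm r j b p : mderivm b (iter j (fps_act r) p) =
      iter j (fps_act r) (mderivm b p).
    by elim: j => //= j <-; rewrite mderivm_fps_act.
  (* Both operators commute with derivatives, so equality of the values at 0 gives equality of the
     k-th powers, and uniqueness of roots identifies [q] with exp ((t / k) A) as an operator. *)
  have QE := @fps_act_root_uniq _ _ q (fps_exp (fps_scale (t / k%:R) A)) k q0
    (fps_exp0 _ A0) k0 _.
  move=> p p0 x; rewrite /E -QE; first exact: Qpos.
  move=> p'; apply: mpoly_eq_mderivm_at0 => b.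
  by rewrite !iter_mderivm -!ev_at0 root0.
move=> s s0; split; first exact: fps_exp0.
move=> _ [p Pp <-] x.
have p0 y : 0 <= ev p y by exact: Pp.
have Ejk j k : (0 < k)%N -> forall y, 0 <= ev (E (j%:R * (t / k%:R)) p) y.
  move=> k0; rewrite /E -iter_fps_act_exp//.
  by elim: j => [//|j IH]; exact: Epos.
pose y : V := \row_i x i.
have -> : meval x (fps_act (fps_exp (fps_scale s A)) p) = ev (E s p) y.
  by apply: meval_eq => i; rewrite mxE.
pose K := mmeasure mdeg p.
(* For fixed p and y the value is a polynomial in r, hence continuous. *)
have EE r : ev (E r p) y = \sum_(k < K) r ^+ k / k`!%:R * ev (iter k (fps_act A) p) y.
  rewrite /E (@fps_act_exp _ _ _ _ _ K)// /ev raddf_sum.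
  by apply: eq_bigr => k _ /=; rewrite mevalZ.
(* The largest multiple of t / (k + 1) not exceeding s. *)
pose sk (k : nat) := (Num.truncn (s * k.+1%:R / t))%:R * (t / k.+1%:R).
have sk_s : sk k @[k --> \oo] --> s.
  apply/cvgrPdist_le => e e0; exists (Num.truncn (t / e)) => // k /= hk.
  have k0 : (0 : R) < k.+1%:R by rewrite ltr0n.
  have st0 : 0 <= s * k.+1%:R / t by rewrite divr_ge0 ?mulr_ge0// ltW.
  have te : t / k.+1%:R <= e.
    rewrite ler_pdivrMr// mulrC -ler_pdivrMr// ltW//.
    by apply: lt_le_trans (truncnS_gt _) _; rewrite ler_nat ltnS.
  have sE : s = (s * k.+1%:R / t) * (t / k.+1%:R).
    by rewrite mulrA divfK ?gt_eqF// mulfK// gt_eqF.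
  have tk0 : 0 < t / k.+1%:R by rewrite divr_gt0.
  have h1 : sk k <= s.
    by rewrite [leRHS]sE /sk ler_pM2r// truncn_le.
  have h2 : s <= sk k + t / k.+1%:R.
    rewrite [leLHS]sE /sk -[X in _ + X]mul1r -mulrDl ler_pM2r// natr1 ltW//.
    exact: truncnS_gt.
  rewrite ger0_norm; last by rewrite subr_ge0.
  by rewrite lerBlDl (le_trans h2)// lerD2l.
have cE : ev (E (sk k) p) y @[k --> \oo] --> ev (E s p) y.
  rewrite EE; under eq_fun do rewrite EE.
  apply: cvg_big => [|i _]; first exact: add_continuous.
  apply: cvgM (cvg_cst _); apply: cvgM (cvg_cst _).
  elim: (i : nat) => [|j IH]; first exact: cvg_cst.
  by under eq_fun do rewrite exprS; rewrite exprS; exact: cvgM.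
have sk_ge0 : \forall k \near \oo, 0 <= ev (E (sk k) p) y.
  by apply: nearW => k; exact: Ejk.
exact: (cvgr_to_ge cE sk_ge0).
Qed.

End Roots.

Theorem theorem4p7 (R : realType) (n : nat) (hn : (0 < n)%N)
  (A : fps n R) (hA : frakd A) :
  [<-> frakd_plus A;
       has_infdiv_representing_measure (fps_exp A);
       exists2 t : R, 0 < t &
         has_infdiv_representing_measure (fps_exp (fps_scale t A));
       forall t : R, 0 < t ->
         has_infdiv_representing_measure (fps_exp (fps_scale t A))].
Proof.
have scale1 : fps_scale 1 A = A.
  by apply/funext => a; rewrite /fps_scale mul1r.
(* Stability under positive scaling lets the first implication, applied to t A, yield the last
   condition. *)
have scale_plus t : 0 < t -> frakd_plus A -> frakd_plus (fps_scale t A).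
  move=> t0 [A0 Ap]; split; first by rewrite /frakd /= /fps_scale A0 mulr0.
  move=> s s0.
  have -> : fps_scale s (fps_scale t A) = fps_scale (s * t) A.
    by apply/funext => a; rewrite /fps_scale mulrA.
  by apply: Ap; rewrite mulr_ge0// ltW.
tfae.
- exact: has_infdiv_of_frakd_plus.
- by move=> h; exists 1 => //; rewrite scale1.
- move=> [s s0 hs] t t0; apply: has_infdiv_of_frakd_plus.
  exact: scale_plus t0 (frakd_plus_of_has_infdiv hA s0 hs).
- by move=> h; apply: (frakd_plus_of_has_infdiv hA ltr01); exact: h.
Qed.
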